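(* Let $n\ge1$, $J\ge 1$, fix $\vec{p}=(p_1,\ldots,p_J)\in[0,1]^J$ and, for $j=1,\ldots,J$, fix a linear subspace $V_j^0\subset\mathbb{R}^n$ of dimension $n_j'$ and let $\pi_j^0$ be the orthogonal projection from $\mathbb{R}^n$ onto $(V_j^0)^\perp$. Then there exists $\nu>0$ such that for every $\epsilon>0$ there exists $C_\epsilon>0$ such that for every $0<\delta\le 1$ the inequality \[ \int_{[-1,1]^n}\prod_{j=1}^J\Big(\sum_{T_j\in\mathbb{T}_j}\chi_{T_j}\Big)^{p_j}\le C_\epsilon\,\delta^{-\epsilon+n}\,\sup_{V\le \mathbb{R}^n}\delta^{-\dim V+\sum_{j=1}^J p_j\dim\pi_j^0(V)}\,\prod_{j=1}^J(\#\mathbb{T}_j)^{p_j} \] holds for all finite collections $\mathbb{T}_j$ ($j=1,\ldots,J$) of $\delta$-neighborhoods of $n_j'$-dimensional affine subspaces of $\mathbb{R}^n$ which, modulo translations, are within a distance $\nu$ of the fixed subspace $V_j^0$. Here the supremum is over all linear subspaces $V$ of $\mathbb{R}^n$.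
   Context: $\chi_T$ denotes the indicator function of a set $T$, and $\#\mathbb{T}_j$ the number of elements of $\mathbb{T}_j$. The distance between $n_j'$-dimensional linear subspaces is the standard metric on the Grassmann manifold of $n_j'$-dimensional subspaces of $\mathbb{R}^n$ (for instance $d(V,W)=\|P_V-P_W\|$ with $P_V,P_W$ the orthogonal projections and $\|\cdot\|$ the operator norm). An affine subspace is within distance $\nu$ of $V_j^0$ modulo translations if the linear subspace parallel to it is within distance $\nu$ of $V_j^0$. *)

(* Defs.v *)
From HB Require Import structures.
From mathcomp Require Import all_boot all_order all_algebra.
From mathcomp Require Import sesquilinear finmap.
From mathcomp Require Import all_classical all_reals all_analysis.
Set Implicit Arguments.
Unset Strict Implicit.
Unset Printing Implicit Defensive.
Import Order.TTheory GRing.Theory Num.Theory.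
Local Open Scope classical_set_scope.
Local Open Scope ring_scope.

Section euclidean.
Context {R : realType} {n : nat}.
Implicit Types (delta nu : R) (a x y : 'rV[R]_n) (V W : {vspace 'rV[R]_n}).

Definition dotv x y : R := (x *m y^T) 0 0.

Lemma dotvE x y : dotv x y = \sum_i x 0 i * y 0 i.
Proof. by rewrite /dotv mxE; apply: eq_bigr => i _; rewrite mxE. Qed.

Let dotv_bilinear : bilinear_for
  (GRing.Scale.Law.clone _ _ *%R _) (GRing.Scale.Law.clone _ _ (idfun \; *%R) _)
  dotv.
Proof.
split=> [y|x] a u v /=; first by rewrite /dotv mulmxDl -scalemxAl !mxE.
by rewrite /dotv linearP mulmxDr -scalemxAr !mxE.
Qed.

HB.instance Definition _ := bilinear_isBilinear.Build R
  'rV[R]_n 'rV[R]_n R _ _ dotv dotv_bilinear.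

Let dotv_sym x y : dotv x y = (-1) ^+ false * idfun (dotv y x).
Proof. by rewrite expr0 mul1r /= !dotvE; apply: eq_bigr => i _; rewrite mulrC. Qed.

HB.instance Definition _ :=
  @isHermitianSesquilinear.Build R 'rV[R]_n false idfun dotv dotv_sym.

Let dotv_gt0 x : x != 0 -> 0 < dotv x x.
Proof.
move=> x0; rewrite dotvE lt0r sumr_ge0 ?andbT; last first.
  by move=> i _; rewrite -expr2 sqr_ge0.
apply: contraNneq x0 => /eqP; rewrite psumr_eq0; last first.
  by move=> i _; rewrite -expr2 sqr_ge0.
move=> /allP x0; apply/eqP/rowP => i; rewrite mxE; apply/eqP.
by have := x0 i (mem_index_enum i); rewrite mulf_eq0 orbb.
Qed.

HB.instance Definition _ := isDotProduct.Build R 'rV[R]_n dotv dotv_gt0.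

Definition enorm x : R := Num.sqrt (dotv x x).

Definition perp V : {vspace 'rV[R]_n} := orthov (@dotv) V.

Definition orthproj V : 'End('rV[R]_n) := daddv_pi V (perp V).

Lemma capv_perp V : (V :&: perp V = 0)%VS.
Proof.
apply/eqP; rewrite -subv0; apply/subvP => x; rewrite memv_cap => /andP[xV].
move=> /mem_orthovP/(_ _ xV) xx0; rewrite memv0; apply: contra_eqT xx0 => x0.
by rewrite gt_eqF// dotv_gt0.
Qed.

Lemma addv_perp V : (V + perp V = fullv)%VS.
Proof.
apply/eqP; rewrite eqEdim subvf dimv_disjoint_sum ?capv_perp//=.
pose f := linfun (mulmxr (\matrix_(i < \dim V) (vbasis V)`_i)^T :
  'rV[R]_n -> 'rV[R]_(\dim V)).
rewrite -(limg_ker_dim f fullv) capfv addnC leq_add//.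
  by rewrite (leq_trans (dimvS (subvf _)))// dimvf /dim/= mul1n.
apply: dimvS; apply/subvP => x; rewrite memv_ker lfunE/= => /eqP xf0.
apply/mem_orthovP => v /coord_vbasis ->; rewrite linear_sumr big1//= => i _.
rewrite linearZr_LR/= [dotv _ _](_ : _ = 0) ?mulr0//.
move/rowP: xf0 => /(_ i); rewrite !mxE => xf0i; apply: etrans xf0i.
by rewrite dotvE; apply: eq_bigr => k _; rewrite !mxE.
Qed.

Lemma orthprojP V x : orthproj V x \in V /\ x - orthproj V x \in perp V.
Proof.
split; first exact: memv_pi.
rewrite -{1}(@daddv_pi_add _ _ V (perp V) x) ?capv_perp ?addv_perp ?memvf//.
by rewrite addrC addKr memv_pi.
Qed.

Definition opnorm (f : 'End('rV[R]_n)) : R :=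
  sup [set enorm (f x) | x in [set x | enorm x <= 1]].

Lemma opnorm_has_sup (f : 'End('rV[R]_n)) :
  has_sup [set enorm (f x) | x in [set x | enorm x <= 1]].
Proof.
split; first by exists (enorm (f 0)), 0 => //=; rewrite /enorm linear0l sqrtr0.
pose M j := \sum_i `|f (delta_mx 0 i) 0 j|.
exists (Num.sqrt (\sum_j M j ^+ 2)) => _ [x /= x1 <-]; rewrite ler_wsqrtr//.
have xi1 i : `|x 0 i| <= 1.
  rewrite (le_trans _ x1)// -sqrtr_sqr ler_wsqrtr// dotvE (bigD1 i)//= -expr2.
  by rewrite lerDl sumr_ge0// => j _; rewrite -expr2 sqr_ge0.
rewrite dotvE ler_sum// => j _; rewrite -expr2 -ler_sqrt ?sqr_ge0//.
rewrite !sqrtr_sqr [leRHS]ger0_norm ?sumr_ge0//.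
rewrite [in leLHS](row_sum_delta x) linear_sum summxE.
rewrite (le_trans (ler_norm_sum _ _ _))// ler_sum// => i _.
by rewrite linearZ mxE normrM ler_piMl.
Qed.

Definition gdist V W : R := opnorm (orthproj V - orthproj W).

Definition affine a V : set 'rV[R]_n := [set a + v | v in [set` V]].

Definition nbhd delta (A : set 'rV[R]_n) : set 'rV[R]_n :=
  [set x | exists2 a, A a & enorm (x - a) < delta].

Definition tube (d : nat) delta nu V0 : set (set 'rV[R]_n) :=
  [set T | exists a V, [/\ \dim V = d, gdist V V0 <= nu &
                           T = nbhd delta (affine a V)]].

End euclidean.

Section lebesgue.
Context {R : realType}.
Local Notation RM := (measurableTypeR R).
Local Open Scope ereal_scope.

Section cons.
Context {n : nat} (mu : {sigma_finite_measure set (n.-tuple RM) -> \bar R}).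

Let tcons (z : RM * n.-tuple RM) : n.+1.-tuple RM := [tuple of z.1 :: z.2].

Let measurable_tcons : measurable_fun [set: RM * n.-tuple RM] tcons.
Proof. exact: measurable_cons. Qed.

Definition lebesgue_cons : set (n.+1.-tuple RM) -> \bar R :=
  pushforward (lebesgue_measure \x mu) tcons.

Let lebesgue_cons0 : lebesgue_cons set0 = 0.
Proof. by rewrite /lebesgue_cons /pushforward preimage_set0 measure0. Qed.

Let lebesgue_cons_ge0 A : 0 <= lebesgue_cons A.
Proof. exact: measure_ge0. Qed.

Let lebesgue_cons_sigma_additive : semi_sigma_additive lebesgue_cons.
Proof.
exact: (@measure_semi_sigma_additive _ _ _
  (measure_function_pushforward__canonical__measure_function_Measure
    (lebesgue_measure \x mu) measurable_tcons)).
Qed.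

HB.instance Definition _ := isMeasure.Build _ _ _ lebesgue_cons
  lebesgue_cons0 lebesgue_cons_ge0 lebesgue_cons_sigma_additive.

Lemma lebesgue_consE (A : set RM) (B : set (n.-tuple RM)) :
  measurable A -> measurable B ->
  lebesgue_cons [set t | A (thead t) /\ B [tuple of behead t]] =
  lebesgue_measure A * mu B.
Proof.
move=> mA mB; rewrite -product_measure1E// /lebesgue_cons /pushforward.
congr (_ _); apply/seteqP; split=> -[x t] /=; rewrite theadE.
  by move=> [? Bt]; split=> //=; rewrite (_ : t = [tuple of behead (x :: t)])//;
    exact/val_inj.
by move=> [? Bt]; split=> //=; rewrite (_ : [tuple of _] = t)//; exact/val_inj.
Qed.

Let lebesgue_cons_sigma_finite : sigma_finite setT lebesgue_cons.
Proof.
have /sigma_finiteP[F [TF ndF Foo]] :=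
  sigma_finiteT (@lebesgue_measure R : {sigma_finite_measure set RM -> \bar R}).
have /sigma_finiteP[G [TG ndG Goo]] := sigma_finiteT mu.
exists (fun k => [set t | F k (thead t) /\ G k [tuple of behead t]]).
  apply/esym; rewrite -subTset => t _.
  have [i _ Fi] : (\bigcup_i F i) (thead t) by rewrite -TF.
  have [j _ Gj] : (\bigcup_i G i) [tuple of behead t] by rewrite -TG.
  exists (maxn i j) => //; split.
    by move: Fi; exact/subsetPset/ndF/leq_maxl.
  by move: Gj; exact/subsetPset/ndG/leq_maxr.
move=> k; have [mF Fk] := Foo k; have [mG Gk] := Goo k; split.
  apply: measurableI; rewrite -[X in measurable X]setTI.
    exact: (measurable_tnth ord0).
  exact: measurable_behead.
by rewrite lebesgue_consE// lte_mul_pinfty// ge0_fin_numE.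
Qed.

HB.instance Definition _ := Measure_isSigmaFinite.Build _ _ _ lebesgue_cons
  lebesgue_cons_sigma_finite.

End cons.

(* The n-fold product of lebesgue_measure on the product (Borel) sigma-algebra
   of n-tuples; lebesgue_tuple_box characterizes it. *)
Fixpoint lebesgue_tuple (n : nat) :
    {sigma_finite_measure set (n.-tuple RM) -> \bar R} :=
  if n is n'.+1 then lebesgue_cons (lebesgue_tuple n') else \d_[tuple].

Lemma lebesgue_tuple_box n (A : 'I_n -> set RM) :
  (forall i, measurable (A i)) ->
  lebesgue_tuple n [set t | forall i, A i (tnth t i)] =
  \prod_(i < n) lebesgue_measure (A i).
Proof.
elim: n A => [|n IHn] A mA /=.
  by rewrite big_ord0 diracE mem_set// => -[].
rewrite big_ord_recl -IHn//= -lebesgue_consE//; last first.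
  rewrite (_ : [set t | _] = \bigcap_(i in [set: 'I_n])
      ((@tnth n RM)^~ i @^-1` A (lift ord0 i))); last first.
    by apply/seteqP; split=> t /= tA i; [move=> _; exact: tA|exact: tA].
  apply: fin_bigcap_measurable => // i _; rewrite -[X in measurable X]setTI.
  exact: measurable_tnth.
congr (lebesgue_cons _ _); apply/seteqP; split=> t /= tA.
  split=> [|i]; first exact: tA.
  by have := tA (lift ord0 i); rewrite [X in tnth X _]tuple_eta tnthS.
move=> i; case: (unliftP ord0 i) => [j|] ->; last exact: tA.1.
by rewrite [X in tnth X _]tuple_eta tnthS; exact: tA.2.
Qed.

End lebesgue.

(* Main.v *)
(* Rescaled by 1/delta, the integral is a sum over a 1-separated set of
   points in a ball of radius N ~ 1/delta, with tubes of bounded width.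
   Let b be the maximum over V of dim V - sum_j p_j dim pi_j(V).

   For exactly parallel tubes the sum is O(N^b prod_j #T_j^p_j). By
   Hoelder's inequality the set of exponents p for which this holds is
   convex, so p may be moved along a line, with sum_j p_j dim pi_j(R^n)
   fixed, until some p_j becomes 0 or 1 or some proper nonzero V attains
   b. A p_j equal to 1 is removed by summing over the fibres of pi_j, and
   a V attaining b splits the problem into one on V, with the same b, and
   one on R^n / V, where b is 0. This is an induction on the dimension and
   on the number of exponents in (0, 1).

   Tubes whose directions are within 1/rho of V_j look parallel in balls
   of radius rho. Iterating the parallel inequality over the scales 1,
   rho, rho^2, ... costs a constant independent of rho at each scale, that
   is N^eps in total when rho is large (Guth's argument).

   Finally dim pi_j(V) is lower semicontinuous in the pair (V_j, V), so by
   compactness of the Grassmannian b does not increase on a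
   nu-neighbourhood of (V_j^0)_j. By compactness again, that neighbourhood
   splits, for each eps, into finitely many cells to which the previous
   estimate applies with a common constant. *)

Require Import Defs.
From mathcomp Require Import all_boot all_order all_algebra finmap.
From mathcomp Require Import all_classical all_reals all_analysis.
From mathcomp Require Import measurable_realfun ring lra.
Set Implicit Arguments.
Unset Strict Implicit.
Unset Printing Implicit Defensive.
Import Order.TTheory GRing.Theory Num.Theory.
Local Open Scope classical_set_scope.
Local Open Scope ring_scope.

(** * Coarse geometry in the sup norm *)

Section coarse.
Context {R : realType} {n : nat}.
Local Notation E := 'rV[R]_n.
Implicit Types (V W K : {vspace E}) (x y z : E) (r s : R).

Lemma dimv_ltS V : (\dim V < n.+1)%N.
Proof. by rewrite ltnS (leq_trans (dimvS (subvf V)))// dimvf /dim/= mul1n. Qed.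

Definition bnd r x : Prop := forall i, `|x 0 i| <= r.

Lemma bnd0 r : 0 <= r -> bnd r 0.
Proof. by move=> r0 i; rewrite mxE normr0. Qed.

Lemma bndD r s x y : bnd r x -> bnd s y -> bnd (r + s) (x + y).
Proof.
by move=> rx sy i; rewrite mxE (le_trans (ler_normD _ _))// lerD.
Qed.

Lemma bndN r x : bnd r x -> bnd r (- x).
Proof. by move=> rx i; rewrite mxE normrN. Qed.

Lemma bndB r s x y : bnd r x -> bnd s y -> bnd (r + s) (x - y).
Proof. by move=> rx /bndN; exact: bndD. Qed.

Lemma bnd_le r s x : r <= s -> bnd r x -> bnd s x.
Proof. by move=> rs rx i; rewrite (le_trans (rx i)). Qed.

Lemma bndZ r (a : R) x : bnd r x -> bnd (`|a| * r) (a *: x).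
Proof. by move=> rx i; rewrite mxE normrM ler_wpM2l. Qed.

Lemma bnd_ex x : exists2 r, 0 <= r & bnd r x.
Proof.
exists (\sum_i `|x 0 i|); first exact: sumr_ge0.
by move=> i; rewrite (bigD1 i)//= lerDl sumr_ge0.
Qed.

Lemma bnd_ex_seq (X : seq E) : exists2 r, 1 <= r & {in X, forall x, bnd r x}.
Proof.
elim: X => [|x X [r r1 rX]]; first by exists 1.
have [s s0 sx] := bnd_ex x; exists (r + s); first lra.
move=> y; rewrite inE => /predU1P[->|yX]; first by apply: bnd_le sx; lra.
by apply: bnd_le (rX _ yX); lra.
Qed.

Lemma bnd_linear (f : 'End(E)) :
  exists2 C, 0 <= C & forall r x, bnd r x -> bnd (C * r) (f x).
Proof.
exists (\sum_j \sum_i `|f (delta_mx 0 i) 0 j|).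
  by apply: sumr_ge0 => i _; exact: sumr_ge0.
move=> r x rx j.
rewrite [in leLHS](row_sum_delta x) linear_sum summxE.
rewrite (le_trans (ler_norm_sum _ _ _))// mulr_suml.
have r0 : 0 <= r by rewrite (le_trans _ (rx j)).
rewrite [leRHS](bigD1 j)//= ler_wpDr//.
  by apply: sumr_ge0 => k _; rewrite mulr_ge0// sumr_ge0.
rewrite mulr_suml ler_sum// => i _.
by rewrite linearZ mxE normrM mulrC ler_wpM2l.
Qed.

(** The closed [r]-neighbourhood of [V] in the sup norm; changing the norm costs only constants
    depending on [n]. *)
Definition nearv V r x : Prop := exists2 v, v \in V & bnd r (x - v).

Lemma nearv_mem V r x : 0 <= r -> x \in V -> nearv V r x.
Proof. by move=> r0 xV; exists x => //; rewrite subrr; exact: bnd0. Qed.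

Lemma nearv_bnd V r x : bnd r x -> nearv V r x.
Proof. by move=> rx; exists 0; rewrite ?mem0v// subr0. Qed.

Lemma nearv_le V r s x : r <= s -> nearv V r x -> nearv V s x.
Proof. by move=> rs [v vV rv]; exists v => //; exact: bnd_le rv. Qed.

Lemma nearv_sub V W r x : (V <= W)%VS -> nearv V r x -> nearv W r x.
Proof. by move=> /subvP VW [v /VW vW rv]; exists v. Qed.

Lemma nearvD V r s x y : nearv V r x -> nearv V s y -> nearv V (r + s) (x + y).
Proof.
move=> [v vV rv] [w wV sw]; exists (v + w); first exact: rpredD.
by rewrite opprD addrACA; exact: bndD.
Qed.

Lemma nearvN V r x : nearv V r x -> nearv V r (- x).
Proof.
move=> [v vV rv]; exists (- v); first by rewrite rpredN.
by rewrite -opprD; exact: bndN.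
Qed.

Lemma nearvB V r s x y : nearv V r x -> nearv V s y -> nearv V (r + s) (x - y).
Proof. by move=> rx /nearvN; exact: nearvD. Qed.

(** With a generalised inverse [g] of [f], the vector [x - g (f x)] lies in the kernel, and [g] is
    bounded. *)
Lemma nearv_ker (f : 'End(E)) : exists2 C, 0 <= C &
  forall r x, bnd r (f x) -> nearv (lker f) (C * r) x.
Proof.
have [C C0 fC] := bnd_linear f^-1%VF; exists C => // r x rfx.
exists (x - (f^-1)%VF (f x)); last by rewrite opprB addrC subrK; exact: fC.
by rewrite memv_ker linearB/= limg_lfunVK ?memv_img ?memvf// subrr.
Qed.

(** If [v] in [V] and [w] in [W] are both close to [x], then [v - w] is small and splits into small
    parts in [V] and [W]. Subtracting the first part from [v] gives a point of both spaces. *)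
Lemma nearv_cap V W : exists2 C, 0 <= C & forall r x, 0 <= r ->
  nearv V r x -> nearv W r x -> nearv (V :&: W) (C * r) x.
Proof.
have [C C0 pC] := bnd_linear (addv_pi1 V W).
exists (C * 2 + 1); first by rewrite addr_ge0 ?mulr_ge0.
move=> r x r0 [v vV rv] [w wW rw].
have vw : v - w \in (V + W)%VS by rewrite memv_add// rpredN.
have e := addv_pi1_pi2 vw.
have ew : v - addv_pi1 V W (v - w) = w + addv_pi2 V W (v - w).
  rewrite -[X in X - _](subrK w) -[X in X + w - _]e addrAC.
  by rewrite (addrC (addv_pi1 _ _ _)) addrK addrC.
exists (v - addv_pi1 V W (v - w)).
  rewrite memv_cap; apply/andP; split; first by rewrite rpredB ?memv_pi1.
  by rewrite ew rpredD ?memv_pi2.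
have rvw : bnd (2 * r) (v - w).
  rewrite (_ : v - w = (x - w) - (x - v)); last first.
    by apply/rowP => i; rewrite !mxE; ring.
  by rewrite mulr_natl mulr2n; exact: bndB.
rewrite (_ : x - _ = addv_pi1 V W (v - w) + (x - v)); last first.
  by apply/rowP => i; rewrite !mxE; ring.
rewrite mulrDl mul1r -mulrA.
by apply: bndD => //; exact: pC.
Qed.


Definition sep (X : seq E) : Prop :=
  uniq X /\ {in X &, forall x y, (forall i, `|(x - y) 0 i| < 1) -> x = y}.

Lemma sep_sub (X Y : seq E) : uniq Y -> {subset Y <= X} -> sep X -> sep Y.
Proof. by move=> uY YX [uX sX]; split=> // x y /YX xX /YX yX; exact: sX. Qed.

Lemma sep_filter (P : pred E) (X : seq E) : sep X -> sep [seq x <- X | P x].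
Proof.
move=> sX; apply: sep_sub (sX); first by rewrite filter_uniq// sX.1.
by move=> x; rewrite mem_filter => /andP[].
Qed.

(** Greedy choice: a point joins the net only when it is far from all points already chosen. *)
Lemma sep_net (Z : seq E) : exists2 Y : seq E, sep Y /\ {subset Y <= Z} &
  {in Z, forall z, exists2 y, y \in Y & bnd 1 (z - y)}.
Proof.
elim: Z => [|z Z [Y [sY YZ] ZY]]; first by exists [::].
have [[y yY zy]|far] := pselect (exists2 y, y \in Y & bnd 1 (z - y)).
  exists Y => [|x]; first by split=> // x /YZ xZ; rewrite inE xZ orbT.
  by rewrite inE => /predU1P[->|/ZY//]; exists y.
exists (z :: Y) => [|x]; last first.
  rewrite inE => /predU1P[->|/ZY[y yY xy]].
    by exists z; rewrite ?mem_head// subrr; exact: bnd0.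
  by exists y; rewrite // inE yY orbT.
have farP y : y \in Y -> ~ (forall i, `|(z - y) 0 i| < 1).
  by move=> yY zy; apply: far; exists y => // i; exact: ltW.
split; last first.
  by move=> x; rewrite !inE => /predU1P[->|/YZ->]; rewrite ?eqxx ?orbT.
split=> /=.
  rewrite sY.1 andbT; apply/negP => /farP; apply=> i.
  by rewrite subrr mxE normr0.
move=> x y; rewrite !inE => /predU1P[->|xY] /predU1P[->|yY] //.
- by move=> /(farP _ yY).
- move=> xz; case: (farP _ xY) => i; rewrite -opprB mxE normrN; exact: xz.
- exact: sY.2.
Qed.

Lemma size_le_card (T : eqType) (F : finType) (f : T -> F) (X : seq T) :
  uniq X -> {in X &, injective f} -> (size X <= #|F|)%N.
Proof.
move=> uX fX; rewrite -(size_map f) cardE uniq_leq_size ?map_inj_in_uniq//.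
by move=> y _; rewrite mem_enum.
Qed.

Lemma inord_truncn_eq (M s t : R) : 0 <= s <= M -> 0 <= t <= M ->
  inord (Num.truncn s) = inord (Num.truncn t) :> 'I_(Num.truncn M).+1 ->
  `|s - t| < 1.
Proof.
move=> /andP[s0 sM] /andP[t0 tM] /(congr1 val).
rewrite !val_insubd !ltnS !le_truncn// => st.
have := truncn_itv s0; have := truncn_itv t0; rewrite st -natr1.
move=> /andP[? ?] /andP[? ?]; rewrite ltr_norml; apply/andP; split; lra.
Qed.

(** The points are encoded injectively by rounding their coordinates along [W], with O([N]) values
    each, and their bounded distance to [W], with O(1) values. *)
Lemma size_sep W r : 0 <= r -> exists2 C, 0 <= C & forall N (X : seq E),
  1 <= N -> sep X ->
  {in X &, forall x y, nearv W r (x - y) /\ bnd N (x - y)} ->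
  (size X)%:R <= C * N `^ (\dim W)%:R.
Proof.
move=> r0; set d := \dim W; pose b := vbasis W.
have [B B1 bB] := bnd_ex_seq b.
pose c (i : 'I_d) (w : E) : R := coord b i w.
have [D D0 cD] : exists2 D, 0 <= D &
    forall s w, 0 <= s -> bnd s w -> forall i, `|c i w| <= D * s.
  exists (\sum_i \sum_k `|c i (delta_mx 0 k)|).
    by apply: sumr_ge0 => i _; exact: sumr_ge0.
  move=> s w s0 sw i; rewrite (bigD1 i)//= mulrDl ler_wpDr//.
    by rewrite mulr_ge0// sumr_ge0// => k _; exact: sumr_ge0.
  rewrite /c [in leLHS](row_sum_delta w) linear_sum mulr_suml.
  rewrite (le_trans (ler_norm_sum _ _ _))// ler_sum// => k _.
  by rewrite linearZ normrM mulrC ler_wpM2l.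
(* Knowing the [d] coordinates up to [1 / M] determines a vector of [W] up to
   [B * d / M <= 1 / 2]. *)
pose M : R := 2 * (B * d%:R + 1).
have M0 : 0 <= M by rewrite mulr_ge0// addr_ge0// mulr_ge0//; lra.
have A0 : 0 <= 2 * (D * (1 + r) * M) + 1.
  have : 0 <= D * (1 + r) * M by rewrite mulr_ge0// mulr_ge0//; lra.
  by lra.
pose K2 := (Num.truncn (4 * r)%R).+1.
exists ((2 * (D * (1 + r) * M) + 1) ^+ d * (K2 ^ n)%:R).
  by rewrite mulr_ge0// exprn_ge0.
move=> N X N1 sX dX; case: X sX dX => [|x0 X'] sX dX.
  by rewrite mulr_ge0 ?powR_ge0// mulr_ge0// exprn_ge0.
move: sX dX; set X := x0 :: X' => sX dX.
have x0X : x0 \in X by rewrite mem_head.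
have /choice[w wP] : forall x, exists w,
    x \in X -> w \in W /\ bnd r (x - x0 - w).
  move=> x; have [xX|xX] := boolP (x \in X); last by exists 0.
  by have [[w wW rw] _] := dX _ _ xX x0X; exists w.
pose L : R := D * (N + r) * M.
have L0 : 0 <= L by rewrite mulr_ge0// mulr_ge0//; lra.
pose K1 := (Num.truncn (2 * L)%R).+1.
pose f x : {ffun 'I_d -> 'I_K1} * {ffun 'I_n -> 'I_K2} :=
  ([ffun i => inord (Num.truncn (c i (w x) * M + L)%R)],
   [ffun k => inord (Num.truncn (2 * (x - x0 - w x) 0 k + 2 * r)%R)]).
have cL x i : x \in X -> 0 <= c i (w x) * M + L <= 2 * L.
  move=> xX; have [wW rw] := wP _ xX.
  have /(cD (N + r)) cw : bnd (N + r) (w x).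
    rewrite -[w x](subKr (x - x0)); apply: bndB => //.
    exact: (dX _ _ xX x0X).2.
  have : `|c i (w x) * M| <= L.
    by rewrite normrM (ger0_norm M0) ler_wpM2r// cw//; lra.
  by rewrite ler_norml => /andP[? ?]; lra.
have uL x k : x \in X -> 0 <= 2 * (x - x0 - w x) 0 k + 2 * r <= 4 * r.
  move=> xX; have [wW rw] := wP _ xX.
  by have := rw k; rewrite ler_norml => /andP[? ?]; lra.
have finj : {in X &, injective f}.
  move=> x y xX yX [/ffunP f1 /ffunP f2]; apply: sX.2 => // k.
  have {}f2 : `|(x - x0 - w x) 0 k - (y - x0 - w y) 0 k| < 1 / 2.
    have := f2 k; rewrite !ffunE => /inord_truncn_eq.
    move=> /(_ (uL _ _ xX) (uL _ _ yX)).
    rewrite !ltr_norml => /andP[? ?]; lra.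
  have {}f1 : `|(w x - w y) 0 k| <= 1 / 2.
    have /coord_vbasis -> : w x - w y \in W.
      by rewrite rpredB//; [have [] := wP _ xX | have [] := wP _ yX].
    rewrite summxE (le_trans (ler_norm_sum _ _ _))//.
    apply: (@le_trans _ _ (\sum_(i < d) B / M)); last first.
      rewrite sumr_const card_ord -[leLHS]mulr_natr mulrAC ler_pdivrMr.
        by rewrite /M; lra.
      by rewrite /M mulr_gt0// ltr_wpDl// mulr_ge0//; lra.
    apply: ler_sum => i _; rewrite mxE normrM linearB/=.
    rewrite mulrC; apply: ler_pM => //.
      by apply: bB; rewrite mem_nth// size_tuple.
    have := f1 i; rewrite !ffunE => /inord_truncn_eq.
    move=> /(_ (cL _ _ xX) (cL _ _ yX)).
    rewrite (_ : _ - _ = (c i (w x) - c i (w y)) * M); last by ring.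
    rewrite normrM (ger0_norm M0) => /ltW.
    have Mgt0 : 0 < M by rewrite /M mulr_gt0// ltr_wpDl// mulr_ge0//; lra.
    by rewrite -ler_pdivlMr// mul1r.
  have -> : (x - y) 0 k = ((x - x0 - w x) 0 k - (y - x0 - w y) 0 k)
     + (w x - w y) 0 k by rewrite !mxE; ring.
  by rewrite (le_lt_trans (ler_normD _ _))//; lra.
have := size_le_card sX.1 finj.
rewrite card_prod !card_ffun !card_ord -(ler_nat R) => /le_trans; apply.
rewrite natrM natrX mulrAC ler_wpM2r// powR_mulrn; last by lra.
have N0 : 0 <= N by lra.
rewrite -exprMn lerXn2r ?nnegrE// ?mulr_ge0//.
have L2 : 0 <= 2 * L by lra.
have /andP[tL _] := truncn_itv L2.
rewrite /K1 -natr1 (le_trans (lerD tL (lexx 1)))//.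
have : L <= D * (1 + r) * M * N.
  rewrite /L [leRHS]mulrAC ler_wpM2r// -mulrA ler_wpM2l// mulrDl mul1r lerD2l.
  by rewrite ler_peMr.
by lra.
Qed.

End coarse.

(** * The discrete Brascamp-Lieb inequality for parallel tubes *)

Section bl.
Context {R : realType} {n J : nat}.
Local Notation E := 'rV[R]_n.
Implicit Types (V W : {vspace E}) (K : 'I_J -> {vspace E}) (p : 'I_J -> R).
Implicit Types (X : seq E) (A : 'I_J -> seq E) (b r N : R) (f g : 'I_J -> nat).

Definition cnt (V : {vspace E}) r (B : seq E) (x : E) : nat :=
  count (fun a => `[< nearv V r (x - a) >]) B.

Lemma cnt_size V r B x : (cnt V r B x <= size B)%N.
Proof. exact: count_size. Qed.

Lemma cnt_le V r s B x : r <= s -> (cnt V r B x <= cnt V s B x)%N.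
Proof. by move=> rs; apply: sub_count => a /asboolP/(nearv_le rs)/asboolP. Qed.

Definition wprod p f : R := \prod_(j < J) (f j)%:R `^ p j.

Lemma wprod_ge0 p f : 0 <= wprod p f.
Proof. by apply: prodr_ge0 => j _; exact: powR_ge0. Qed.

Lemma wprod_le p f g : (forall j, 0 <= p j) -> (forall j, (f j <= g j)%N) ->
  wprod p f <= wprod p g.
Proof.
move=> p0 fg; apply: ler_prod => j _; rewrite powR_ge0/=.
by rewrite ge0_ler_powR ?nnegrE// ler_nat.
Qed.

(* With [pi_j : R^n -> R^n / K j], this is the regularised Brascamp-Lieb
   inequality [sum_X prod_j (f_j o pi_j)^p_j <= C N^b prod_j |f_j|_1^p_j] for
   sums [f_j] of indicators of balls of bounded radius, where [X] is a
   1-separated set of diameter [N] lying near a translate of [W]. *)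
Definition BL p K W b : Prop := forall r, 0 <= r -> exists2 C, 0 <= C &
  forall N X A, 1 <= N -> sep X ->
  {in X &, forall x y, nearv W r (x - y) /\ bnd N (x - y)} ->
  \sum_(x <- X) wprod p (fun j => cnt (K j) r (A j) x) <=
    C * N `^ b * wprod p (fun j => size (A j)).

Lemma BL_le p K W b b' : b <= b' -> BL p K W b -> BL p K W b'.
Proof.
move=> bb' H r /H[C C0 HC]; exists C => // N X A N1 sX dX.
rewrite (le_trans (HC _ _ _ N1 sX dX))// ler_wpM2r ?wprod_ge0// ler_wpM2l//.
exact: ler_powR.
Qed.

Lemma sumr_const_seq (T : Type) (s : seq T) (c : R) :
  \sum_(x <- s) c = (size s)%:R * c.
Proof. by rewrite big_const_seq count_predT iter_addr_0 mulr_natl. Qed.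

Lemma BL_size p K W : (forall j, 0 <= p j) -> BL p K W (\dim W)%:R.
Proof.
move=> p0 r /(size_sep W)[C C0 HC]; exists C => // N X A N1 sX dX.
rewrite (le_trans _ (ler_wpM2r (wprod_ge0 _ _) (HC _ _ N1 sX dX)))//.
rewrite -sumr_const_seq; apply: ler_sum => x _; apply: wprod_le => // j.
exact: cnt_size.
Qed.

Definition reset p i : 'I_J -> R := fun j => if j == i then 0 else p j.

Lemma wprod_reset p i f : p i = 1 -> wprod p f = (f i)%:R * wprod (reset p i) f.
Proof.
move=> pi; rewrite /wprod (bigD1 i)//= pi powRr1// [in RHS](bigD1 i)//=.
rewrite /reset eqxx powRr0 mul1r; congr (_ * _); apply: eq_bigr => j.
by move=> /negPf ->.
Qed.

(* For an exponent equal to 1, sum first over the fibres of [pi_i]. *)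
Lemma BL_fiber p K W b i : (forall j, 0 <= p j) -> p i = 1 ->
  BL (reset p i) K (W :&: K i) b -> BL p K W b.
Proof.
move=> p0 pi H r r0; have [D D0 capD] := nearv_cap W (K i).
have r1 : 0 <= D * (2 * r) by rewrite mulr_ge0// mulr_ge0.
(* Two points over the same [a] differ by a vector within [2 * r] of both [W] and [K i]. The extra
   [r] lets the larger radius dominate the counts. *)
have [C C0 HC] := H (D * (2 * r) + r) (addr_ge0 r1 r0).
exists C => // N X A N1 sX dX.
under eq_bigr => x _.
  rewrite (wprod_reset _ pi) [X in X%:R * _]/cnt -sum1_count natr_sum mulr_suml.
  rewrite big_mkcond/=.
  over.
rewrite exchange_big/= (wprod_reset _ pi) mulrCA -sumr_const_seq.
apply: ler_sum => a _; rewrite -big_mkcond/= -big_filter.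
have sX' := sep_filter (fun x => `[< nearv (K i) r (x - a) >]) sX.
apply: le_trans (HC _ _ A N1 sX' _).
  apply: ler_sum => x _; rewrite mul1r; apply: wprod_le => j.
    by rewrite /reset; case: eqP.
  by apply: cnt_le; rewrite lerDr.
move=> x y; rewrite !mem_filter => /andP[/asboolP xa xX] /andP[/asboolP ya yX].
have [dxy Nxy] := dX _ _ xX yX; split=> //.
apply: nearv_le (capD (2 * r) _ _ _ _).
- by rewrite lerDl.
- by rewrite mulr_ge0.
- by apply: nearv_le dxy; lra.
- rewrite (_ : x - y = (x - a) - (y - a)); last first.
    by apply/rowP => k; rewrite !mxE; ring.
  by rewrite mulr_natl mulr2n; exact: nearvB.
Qed.

(* Fubini for [V <= W]: the inner sums run over translates of [V], the outer one
   over a net of [W / V], represented by the complement [W :\: V]. *)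
Lemma BL_split p K V W b : (forall j, 0 <= p j) -> (V <= W)%VS -> BL p K V b ->
  BL p (fun j => (K j + V)%VS) (W :\: V)%VS 0 -> BL p K W b.
Proof.
move=> p0 VW HV HW r r0.
have r1 : 0 <= 2 + 2 * r by lra.
have r2 : 0 <= 1 + 2 * r by lra.
have [C1 C10 HC1] := HV _ r1; have [C2 C20 HC2] := HW _ r2.
exists (C1 * C2) => [|N X A N1 sX dX]; first by rewrite mulr_ge0.
case: X sX dX => [|x0 X'] sX dX.
  by rewrite big_nil !mulr_ge0 ?powR_ge0 ?wprod_ge0.
move: sX dX; set X := x0 :: X' => sX dX.
have x0X : x0 \in X by rewrite mem_head.
have /choice[vz vzP] : forall x, exists vz : E * E, x \in X ->
    [/\ vz.1 \in V, vz.2 \in (W :\: V)%VS & bnd r (x - x0 - vz.1 - vz.2)].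
  move=> x; have [xX|xX] := boolP (x \in X); last by exists (0, 0).
  have [[w wW rw] _] := dX _ _ xX x0X.
  have : w \in (W :\: V + W :&: V)%VS by rewrite addv_diff_cap.
  rewrite (capv_idPr VW) => /memv_addP[z zW [v vV ew]].
  exists (v, z) => _; split => //=.
  by rewrite -addrA -opprD [v + z]addrC -ew.
pose z x := (vz x).2.
have [Y [sY YZ] ZY] := sep_net (map z X).
have YW y : y \in Y -> y \in (W :\: V)%VS.
  by move=> /YZ/mapP[x xX ->]; have [] := vzP _ xX.
pose Xy y := [seq x <- X | `[< bnd 1 (z x - y) >]].
(* Only these tubes can meet the slice over [y]; their number is the integrand of the outer sum. *)
pose Ay y j := [seq a <- A j | `[< nearv (K j + V) (1 + 2 * r) (x0 + y - a) >]].
have XyP y : \sum_(x <- Xy y) wprod p (fun j => cnt (K j) r (A j) x) <=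
    C1 * N `^ b * wprod p (fun j => cnt (K j + V) (1 + 2 * r) (A j) (x0 + y)).
  apply: (@le_trans _ _ (\sum_(x <- Xy y)
      wprod p (fun j => cnt (K j) (2 + 2 * r) (Ay y j) x))).
    rewrite big_seq [leRHS]big_seq; apply: ler_sum => x.
    rewrite mem_filter => /andP[/asboolP zxy xX]; apply: wprod_le => // j.
    rewrite /cnt count_filter; apply: sub_count => a /asboolP xa/=.
    apply/andP; split; apply/asboolP; first by apply: nearv_le xa; lra.
    have [vV zW rx] := vzP _ xX.
    rewrite (_ : x0 + y - a = (x - a) - (vz x).1
       - (x - x0 - (vz x).1 - (vz x).2) - (z x - y)); last first.
      by apply/rowP => k; rewrite !mxE; ring.
    rewrite [1 + _]addrC; apply: nearvB; last exact: nearv_bnd.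
    rewrite mulr_natl mulr2n; apply: nearvB; last exact: nearv_bnd.
    rewrite -[r in nearv _ r _]addr0; apply: nearvB.
      by apply: nearv_sub xa; exact: addvSl.
    by apply: nearv_mem => //; apply: subvP vV; exact: addvSr.
  rewrite (le_trans (HC1 N _ (Ay y) N1 (sep_filter _ sX) _))//.
    move=> x x'; rewrite !mem_filter.
    move=> /andP[/asboolP xy xX] /andP[/asboolP xy' xX'].
    have [dxx Nxx] := dX _ _ xX xX'; split=> //.
    have [vV zW rx] := vzP _ xX; have [vV' zW' rx'] := vzP _ xX'.
    exists ((vz x).1 - (vz x').1); first by rewrite rpredB.
    rewrite (_ : x - x' - _ = (z x - y) - (z x' - y) +
      ((x - x0 - (vz x).1 - (vz x).2) -
       (x' - x0 - (vz x').1 - (vz x').2))); last first.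
      by apply/rowP => k; rewrite !mxE; ring.
    by rewrite !mulr_natl !mulr2n; apply: bndD; apply: bndB.
  rewrite ler_wpM2l ?mulr_ge0 ?powR_ge0// wprod_le// => j.
  by rewrite /Ay size_filter.
apply: (@le_trans _ _ (\sum_(y <- Y) \sum_(x <- Xy y)
    wprod p (fun j => cnt (K j) r (A j) x))).
  under [leRHS]eq_bigr do rewrite big_filter big_mkcond/=.
  rewrite exchange_big/= big_seq [leRHS]big_seq; apply: ler_sum => x xX.
  have [y yY zxy] := ZY _ (map_f z xX).
  rewrite (big_rem y)//= asboolT// lerDl sumr_ge0// => y' _.
  by case: ifP; rewrite ?wprod_ge0.
apply: le_trans (ler_sum _ (fun y _ => XyP y)) _.
rewrite -mulr_sumr (_ : C1 * C2 * _ * _ =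
  C1 * N `^ b * (C2 * wprod p (fun j => size (A j)))); last by ring.
rewrite ler_wpM2l ?mulr_ge0 ?powR_ge0//.
(* Any bound on the diameter of [Y] will do, since the outer inequality has exponent 0. *)
have [N' N'1 N'Y] := bnd_ex_seq Y.
pose A' j := [seq a - x0 | a <- A j].
apply: le_trans (le_trans (HC2 (N' + N') Y A' _ sY _) _).
- apply: ler_sum => y _; apply: wprod_le => // j.
  rewrite /cnt count_map; apply: sub_count => a /asboolP ya/=; apply/asboolP.
  rewrite (_ : y - (a - x0) = x0 + y - a)//.
  by apply/rowP => k; rewrite !mxE; ring.
- by lra.
- move=> y y' yY yY'; split; last by apply: bndB; exact: N'Y.
  by apply: nearv_mem => //; rewrite rpredB// YW.
- rewrite powRr0 mulr1 ler_wpM2l// wprod_le// => j.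
  by rewrite size_map.
Qed.


(** * Hoelder's inequality and interpolation between exponents *)

Lemma hoelder_seq (T : Type) (s : seq T) (u v : T -> R) (t U V : R) :
  0 < t < 1 -> (forall x, 0 <= u x) -> (forall x, 0 <= v x) ->
  \sum_(x <- s) u x <= U -> \sum_(x <- s) v x <= V ->
  \sum_(x <- s) u x `^ t * v x `^ (1 - t) <= U `^ t * V `^ (1 - t).
Proof.
move=> /andP[t0 t1] u0 v0 uU vV; have t'0 : 0 < 1 - t by lra.
apply: (@le_trans _ _
  ((\sum_(x <- s) u x) `^ t * (\sum_(x <- s) v x) `^ (1 - t))).
  elim: s {uU vV} => [|x s IH].
    by rewrite !big_nil mulr_ge0 ?powR_ge0.
  rewrite !big_cons (le_trans (lerD (lexx _) IH))//.
  have su : 0 <= \sum_(x <- s) u x by exact: sumr_ge0.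
  have sv : 0 <= \sum_(x <- s) v x by exact: sumr_ge0.
  (* The two-term inequality, with exponents [t^-1] and [(1 - t)^-1], merges the head with the sum
     over the tail. *)
  have := @hoelder2 _ (u x `^ t) ((\sum_(x <- s) u x) `^ t)
    (v x `^ (1 - t)) ((\sum_(x <- s) v x) `^ (1 - t)) t^-1 (1 - t)^-1.
  rewrite !powR_ge0 !invr_gt0 !invrK -!powRrM !mulfV ?gt_eqF// !powRr1//.
  by apply=> //; lra.
have U0 : 0 <= U by apply: le_trans uU; exact: sumr_ge0.
have V0 : 0 <= V by apply: le_trans vV; exact: sumr_ge0.
by apply: ler_pM; rewrite ?powR_ge0// ge0_ler_powR ?nnegrE ?sumr_ge0// ltW.
Qed.

Lemma wprod_powR p f t : wprod p f `^ t = wprod (fun j => t * p j) f.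
Proof.
rewrite /wprod; suff [_ ->//] : 0 <= \prod_(j < J) (f j)%:R `^ p j /\
  (\prod_(j < J) (f j)%:R `^ p j) `^ t = \prod_(j < J) (f j)%:R `^ (t * p j).
elim/big_rec2 : _ => [|j x y _ [y0 IH]]; first by rewrite powR1.
split; first by rewrite mulr_ge0 ?powR_ge0.
by rewrite powRM ?powR_ge0// IH -powRrM [p j * t]mulrC.
Qed.

Lemma BL_interpolation p q K W b c t : 0 < t < 1 ->
  (forall j, 0 <= p j) -> (forall j, 0 <= q j) ->
  BL p K W b -> BL q K W c ->
  BL (fun j => t * p j + (1 - t) * q j) K W (t * b + (1 - t) * c).
Proof.
move=> /andP[t0 t1] p0 q0 Hp Hq r r0.
have [C C0 HC] := Hp _ r0; have [D D0 HD] := Hq _ r0.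
have wprodI f : wprod (fun j => t * p j + (1 - t) * q j) f =
    wprod p f `^ t * wprod q f `^ (1 - t).
  rewrite !wprod_powR /wprod -big_split/=; apply: eq_bigr => j _.
  have tp : 0 <= t * p j by rewrite mulr_ge0// ltW.
  have tq : 0 <= (1 - t) * q j by rewrite mulr_ge0//; lra.
  (* Adding exponents at base 0 needs a nonzero sum; a zero sum of nonnegative terms makes both
     vanish. *)
  have [/eqP|s0] := eqVneq (t * p j + (1 - t) * q j) 0; last first.
    by rewrite powRD// (negPf s0).
  rewrite paddr_eq0// => /andP[/eqP-> /eqP->].
  by rewrite addr0 powRr0 mulr1.
exists (C `^ t * D `^ (1 - t)); first by rewrite mulr_ge0 ?powR_ge0.
move=> N X A N1 sX dX.
under eq_bigr do rewrite wprodI.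
have N0 : N != 0 by rewrite gt_eqF//; lra.
have -> : N `^ (t * b + (1 - t) * c) = (N `^ b) `^ t * (N `^ c) `^ (1 - t).
  by rewrite -!powRrM -powRD ?N0 ?implybT// [b * t]mulrC [c * _]mulrC.
rewrite wprodI.
have := hoelder_seq _ (fun x => wprod_ge0 _ _) (fun x => wprod_ge0 _ _)
  (HC _ _ _ N1 sX dX) (HD _ _ _ N1 sX dX).
move=> /(_ A A t); rewrite t0 t1 => /(_ isT)/le_trans; apply.
by rewrite !powRM ?mulr_ge0 ?powR_ge0 ?wprod_ge0// mulrACA (mulrACA (C `^ t)).
Qed.

End bl.

(** Ratio test: [t] is the smallest [a i / - c i] over the decreasing constraints. *)
Lemma line_exit (R : realType) (I : finType) (a c : I -> R) :
  (forall i, 0 <= a i) -> (exists i, c i < 0) ->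
  exists2 t, 0 <= t & (forall i, 0 <= a i + t * c i) /\
    exists2 i, c i < 0 & a i + t * c i = 0.
Proof.
move=> a0 [i0 ci0]; case: (@arg_minP _ _ _ i0 (fun i => c i < 0)
  (fun i => a i / - c i) ci0) => i ci imin.
have ci' : 0 < - c i by rewrite oppr_gt0.
exists (a i / - c i); first by rewrite divr_ge0// ltW.
split; last first.
  exists i => //; rewrite mulrC invrN mulrN mulrN mulrCA mulfV ?lt_eqF//.
  by rewrite mulr1 subrr.
move=> j; have [cj|cj] := ltP (c j) 0; last first.
  by rewrite addr_ge0// mulr_ge0// divr_ge0// ltW.
have := imin _ cj; rewrite ler_pdivlMr ?oppr_gt0// mulrN; lra.
Qed.

(** * The Brascamp-Lieb exponent and its critical subspaces *)

Section bl_exc.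
Context {R : realType} {n J : nat}.
Local Notation E := 'rV[R]_n.
Implicit Types (U V W : {vspace E}) (K : 'I_J -> {vspace E}) (p d : 'I_J -> R).
Implicit Types (b t : R).

(* [rk K j V] is the dimension of the image of [V] in [R^n / K j]. *)
Definition rk K j V : R := (\dim (V + K j))%:R - (\dim (K j))%:R.

Definition exc p K V : R := (\dim V)%:R - \sum_j p j * rk K j V.

Lemma rkE K j V : rk K j V = (\dim V)%:R - (\dim (V :&: K j))%:R.
Proof.
rewrite /rk; have /(congr1 (fun k => k%:R : R)) := dimv_sum_cap V (K j).
by rewrite !natrD; lra.
Qed.

Lemma rk0 K j : rk K j 0 = 0.
Proof. by rewrite /rk add0v subrr. Qed.

Lemma exc0 p K : exc p K 0 = 0.
Proof.
by rewrite /exc dimv0 big1 ?subr0// => j _; rewrite rk0 mulr0.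
Qed.

(** [K j + V] is the kernel of the map induced by [pi_j] on the quotient by [V], and dimensions are
    additive along it. *)
Lemma exc_quot p K U V : (U :&: V = 0)%VS ->
  exc p (fun j => K j + V)%VS U = exc p K (U + V) - exc p K V.
Proof.
move=> UV; rewrite /exc dimv_disjoint_sum// natrD.
suff -> : \sum_j p j * rk (fun j => K j + V)%VS j U =
  \sum_j p j * rk K j (U + V) - \sum_j p j * rk K j V by lra.
rewrite -sumrB; apply: eq_bigr => j _; rewrite -mulrBr; congr (_ * _).
by rewrite /rk -(addvA U) (addvC V (K j)); lra.
Qed.

Lemma exc_line p d t K V :
  exc (fun j => p j + t * d j) K V = exc p K V - t * \sum_j d j * rk K j V.
Proof.
rewrite /exc -addrA -opprD; congr (_ - _).
rewrite mulr_sumr -big_split/=; apply: eq_bigr => j _.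
by rewrite mulrDl mulrA.
Qed.

Lemma exc_reset p K U i : (U <= K i)%VS -> exc (reset p i) K U = exc p K U.
Proof.
move=> /addv_idPr UK; rewrite /exc; congr (_ - _); apply: eq_bigr => j _.
by rewrite /reset; case: eqP => // ->; rewrite /rk UK subrr !mulr0.
Qed.

(** [exc p K V] depends on [V] only through finitely many dimensions. One representative is picked
    per tuple of dimensions, 0 if the tuple does not occur. *)
Lemma exc_finite K W : exists (S : finType) (V_ : S -> {vspace E}),
  (forall s, (V_ s <= W)%VS) /\
  forall V, (V <= W)%VS -> exists s, forall p, exc p K V = exc p K (V_ s).
Proof.
pose sg V : 'I_n.+1 * {ffun 'I_J -> 'I_n.+1} :=
  (inord (\dim V), [ffun j => inord (\dim (V + K j))]).
have sgE V V' q : sg V = sg V' -> exc q K V = exc q K V'.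
  move=> [/(congr1 val)]; rewrite /= !inordK ?dimv_ltS// => e /ffunP ee.
  rewrite /exc e; congr (_ - _); apply: eq_bigr => j _.
  have := ee j; rewrite !ffunE => /(congr1 val).
  by rewrite /= !inordK ?dimv_ltS// /rk => ->.
exists ('I_n.+1 * {ffun 'I_J -> 'I_n.+1})%type.
exists (fun s => xget 0%VS [set V | (V <= W)%VS /\ sg V = s]); split.
  by move=> s; case: xgetP => [V _ []//|_]; rewrite sub0v.
move=> V VW; exists (sg V) => p; apply: sgE.
by case: xgetP => [V' _ []//|/(_ V)[]].
Qed.

Definition free p := [pred j | 0 < p j < 1].

(* [exc _ K V] and the box constraints are affine in the exponents, so moving
   along [d] must stop at a new facet; the choice of [d] keeps [V = 0] and
   [V = W] from being that facet. *)
Lemma exit_point p K W b d : (forall j, 0 <= p j <= 1) ->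
  (forall V, (V <= W)%VS -> exc p K V <= b) ->
  (forall j, d j != 0 -> free p j) -> (exists j, d j != 0) ->
  \sum_j d j * rk K j W = 0 ->
  exists2 t, 0 <= t & let q := fun j => p j + t * d j in
  [/\ (forall j, 0 <= q j <= 1), (forall V, (V <= W)%VS -> exc q K V <= b) &
      (exists2 j, free p j & ~~ free q j) \/
      (exists V, [/\ (V <= W)%VS, V != 0%VS, V != W & exc q K V = b])].
Proof.
move=> p01 pb df [j0 dj0] dW.
have [S [V_ [V_W HV]]] := exc_finite K W.
pose slope V := \sum_j d j * rk K j V.
(* Values and slopes along [d] of the constraints [0 <= p j], [p j <= 1] and
   [exc p K (V_ s) <= b]. *)
pose a (i : 'I_J + 'I_J + S) := match i with
  | inl (inl j) => p j | inl (inr j) => 1 - p j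
  | inr s => b - exc p K (V_ s) end.
pose c (i : 'I_J + 'I_J + S) := match i with
  | inl (inl j) => d j | inl (inr j) => - d j | inr s => slope (V_ s) end.
have [||t t0 [tok [i ci ti]]] := @line_exit _ _ a c.
- move=> [[j|j]|s] /=; first by have /andP[] := p01 j.
    by have /andP[_] := p01 j; rewrite subr_ge0.
  by rewrite subr_ge0 pb.
- have [dneg|dpos] := ltP (d j0) 0; first by exists (inl (inl j0)).
  by exists (inl (inr j0)); rewrite /= oppr_lt0 lt0r dj0.
exists t => // q; split.
- move=> j; have := tok (inl (inl j)); have := tok (inl (inr j)) => /=.
  by rewrite /q; lra.
- move=> V VW; have [s ->] := HV V VW.
  by have := tok (inr s); rewrite /= /q exc_line -/(slope _); lra.
case: i ci ti => [[j|j]|s] /= ci ti.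
- left; exists j; first by apply: df; rewrite lt_eqF.
  by rewrite /= /q ti ltxx.
- left; exists j; first by apply: df; rewrite gt_eqF// -oppr_lt0.
  rewrite /= /q (_ : p j + t * d j = 1); last by lra.
  by rewrite ltxx andbF.

- right; exists (V_ s); split => //.
  + apply: contraTneq ci => ->; rewrite /slope big1 ?ltxx// => j _.
    by rewrite rk0 mulr0.
  + by apply: contraTneq ci => ->; rewrite /slope dW ltxx.
  + by rewrite /q exc_line -/(slope _); lra.
Qed.

Lemma card_free_lt p q : (forall j, free q j -> free p j) ->
  (exists2 j, free p j & ~~ free q j) -> (#|free q| < #|free p|)%N.
Proof.
move=> qp [j pj qj]; apply: proper_card; apply/properP; split.
  by apply/fintype.subsetP => i; exact: qp.
by exists j.
Qed.

(** The outer induction is on [\dim W], with [K] generalised because a quotient replaces [K j] by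
    [K j + V]. The inner one is on [#|free p|]. *)
Theorem BL_exc p K W b : (forall j, 0 <= p j <= 1) ->
  (forall V, (V <= W)%VS -> exc p K V <= b) -> BL p K W b.
Proof.
have [m] := ubnP (\dim W); elim: m => // m IHm in p K W b *.
rewrite ltnS => Wm.
have [f] := ubnP #|free p|; elim: f => // f IHf in p b *.
rewrite ltnS => pf p01 pb.
have p0 j : 0 <= p j by have /andP[] := p01 j.
(* Fibring over [pi_i] lowers the dimension exactly when [W] is not contained in [K i]; otherwise
   [rk K i W] is 0. *)
have [[i pi1 iW]|red] := pselect (exists2 i, p i = 1 & ~~ (W <= K i)%VS).
  apply: BL_fiber pi1 _ => //; apply: IHm.
  - rewrite (leq_trans _ Wm)// ltn_neqAle dimvS ?capvSl// andbT.
    apply: contra iW => /eqP dW; apply/capv_idPl/eqP.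
    by rewrite eqEdim capvSl dW/=.
  - by move=> j; rewrite /reset; case: eqP => // _; rewrite lexx ler01.
  - move=> V VWK; rewrite exc_reset ?(subv_trans VWK) ?capvSr//.
    by apply: pb; rewrite (subv_trans VWK) ?capvSl.
have p1rk j : p j = 1 -> rk K j W = 0.
  move=> pj1; have [/addv_idPr WK|WK] := boolP (W <= K j)%VS.
    by rewrite /rk WK subrr.
  by case: red; exists j.
have rigid j : ~~ free p j -> p j * rk K j W = 0.
  rewrite /free/= negb_and -!leNgt => /orP[pj|pj].
    have -> : p j = 0 by apply/eqP; rewrite eq_le pj p0.
    by rewrite mul0r.
  rewrite p1rk ?mulr0//; apply/eqP; rewrite eq_le pj andbT.
  by have /andP[] := p01 j.
have [[i ifree]|nofree] := pselect (exists i, free p i); last first.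
  (* With no free exponent, [exc p K W] equals [\dim W], so counting the points of [X] suffices. *)
  apply: BL_le (pb _ (subvv W)) _.
  rewrite /exc big1 ?subr0; first exact: BL_size.
  move=> j _; apply: rigid; apply/negP => pj; apply: nofree; by exists j.
have /andP[pi0 pi1] := ifree.
have [[k kfree ki]|onefree] :=
  pselect (exists2 k, free p k & k != i); last first.
  (* [p] lies between its modifications with [p i] replaced by 0 and by 1. *)
  pose p1 j := if j == i then 1 else p j.
  have p1E : p = (fun j => p i * p1 j + (1 - p i) * reset p i j).
    apply/funext => j; rewrite /p1 /reset; case: eqP => [->|_]; first by ring.
    by ring.
  (* The left side equals [exc p K W], and interpolates the trivial counts on the fibre [W :&: K i]
     and on [W]. *)
  have Wb : p i * (\dim (W :&: K i))%:R + (1 - p i) * (\dim W)%:R <= b.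
    apply: le_trans (pb _ (subvv W)).
    rewrite /exc (bigD1 i)//= big1 ?addr0 ?rkE; first by lra.
    move=> j ji; apply: rigid; apply/negP => pj; apply: onefree; by exists j.
  apply: BL_le Wb _; rewrite [p in BL p]p1E.
  have r0 j : 0 <= reset p i j by rewrite /reset; case: eqP.
  have p10 j : 0 <= p1 j by rewrite /p1; case: eqP.
  apply: BL_interpolation => //.
    apply: (@BL_fiber _ _ _ _ _ _ _ i) => //; first by rewrite /p1 eqxx.
    by apply: BL_size => j; rewrite /reset; case: eqP.
  exact: BL_size.
(* A nonzero direction supported on two free exponents along which [exc] at [W] is constant. *)
pose d j := if j == i then (if rk K i W == 0 then 1 else rk K k W)
  else if j == k then - rk K i W else 0.
have dW : \sum_j d j * rk K j W = 0.
  rewrite (bigD1 i)//= (bigD1 k)//= big1 ?addr0; last first.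
    by move=> j /andP[/negPf ji /negPf jk]; rewrite /d ji jk mul0r.
  rewrite /d eqxx (negPf ki) eqxx; case: eqP => [->|_]; last by ring.
  by rewrite oppr0 mulr0 mul0r addr0.
have dfree j : d j != 0 -> free p j.
  rewrite /d; have [->//|_] := eqVneq j i; have [->//|_] := eqVneq j k.
  by rewrite eqxx.
have dneq0 : exists j, d j != 0.
  have [ri|ri] := eqVneq (rk K i W) 0.
    by exists i; rewrite /d eqxx ri eqxx oner_eq0.
  by exists k; rewrite /d (negPf ki) eqxx oppr_eq0.
(* At a stopping point either an exponent has ceased to be free, or a critical [V] splits the
   problem. In the second case [exc] on the quotient is [exc q K (U + V) - b <= 0]. *)
have endpoint d' t : (forall j, d' j != 0 -> free p j) ->
    let q := fun j => p j + t * d' j in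
    [/\ (forall j, 0 <= q j <= 1), (forall V, (V <= W)%VS -> exc q K V <= b) &
      (exists2 j, free p j & ~~ free q j) \/
      (exists V, [/\ (V <= W)%VS, V != 0%VS, V != W & exc q K V = b])] ->
    (forall j, 0 <= q j) /\ BL q K W b.
  move=> d'free q [q01 qb tight].
  have q0 j : 0 <= q j by have /andP[] := q01 j.
  split=> //; case: tight => [lost|[V [VW V0 VnW Vb]]].
    apply: IHf => //; apply: leq_trans pf; apply: card_free_lt => // j.
    have [d'j|/d'free//] := eqVneq (d' j) 0.
    by rewrite /free/= /q d'j mulr0 addr0.
  have dV : (\dim V < m)%N.
    rewrite (leq_trans _ Wm)// ltn_neqAle dimvS// andbT.
    by apply: contra VnW => /eqP dV; rewrite eqEdim VW dV/=.
  apply: (BL_split q0 VW).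
    by apply: IHm => // U UV; apply: qb; exact: subv_trans UV VW.
  have capWV : ((W :\: V) :&: V = 0)%VS by exact: capv_diff.
  apply: IHm => //.
    rewrite (leq_trans _ Wm)// -(addn0 (\dim (W :\: V))).
    have -> : \dim W = (\dim (W :\: V) + \dim V)%N.
      by rewrite -dimv_disjoint_sum// addv_diff (addv_idPl VW).
    by rewrite ltn_add2l lt0n dimv_eq0.
  move=> U UWV; have UV0 : (U :&: V = 0)%VS.
    by apply/eqP; rewrite -subv0 -capWV capvS.
  rewrite exc_quot// Vb subr_le0; apply: qb.
  by rewrite subv_add VW (subv_trans UWV)// diffvSl.
have dN j : - d j != 0 -> free p j by rewrite oppr_eq0; exact: dfree.
have [t t0 /(endpoint _ _ dfree)[tq0 tq]] := exit_point p01 pb dfree dneq0 dW.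
have [||s s0 /(endpoint _ _ dN)[sq0 sq]] := exit_point p01 pb dN.
  by have [j dj] := dneq0; exists j; rewrite oppr_eq0.
  by under eq_bigr do rewrite mulNr; rewrite sumrN dW oppr0.
have [t00|tn0] := eqVneq t 0.
  move: tq; rewrite t00 (_ : (fun j => _) = p)//.
  by apply/funext => j; rewrite mul0r addr0.
have [s00|sn0] := eqVneq s 0.
  move: sq; rewrite s00 (_ : (fun j => _) = p)//.
  by apply/funext => j; rewrite mul0r addr0.
have {tn0}t0 : 0 < t by rewrite lt0r tn0.
have {sn0}s0 : 0 < s by rewrite lt0r sn0.
have th : 0 < s / (t + s) < 1.
  by rewrite divr_gt0 ?addr_gt0// ltr_pdivrMr ?addr_gt0// mul1r ltrDr.
have e1 : t + s != 0 by rewrite gt_eqF// addr_gt0.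
(* If neither stopping time is 0, [p] lies strictly between the two stopping points. *)
have -> : p = (fun j => s / (t + s) * (p j + t * d j) +
    (1 - s / (t + s)) * (p j + s * - d j)).
  by apply/funext => j; field.
rewrite (_ : b = s / (t + s) * b + (1 - s / (t + s)) * b); last by ring.
exact: BL_interpolation.
Qed.

End bl_exc.

(** * Induction on scales *)

Section multiscale.
Context {R : realType} {n J : nat}.
Local Notation E := 'rV[R]_n.
Local Notation tubes := (seq (E * {vspace E})).
Implicit Types (V W : {vspace E}) (K : 'I_J -> {vspace E}) (p : 'I_J -> R).
Implicit Types (X : seq E) (T : 'I_J -> tubes) (b r N C : R).

Definition cntT r (S : tubes) (x : E) : nat :=
  count (fun t => `[< nearv t.2 r (x - t.1) >]) S.

(** A one-sided and scale-invariant angle condition: only the slope of [V] relative to [W] is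
    bounded. *)
Definition angle_le (eta : R) V W : Prop :=
  forall L v, 0 <= L -> v \in V -> bnd L v -> nearv W (eta * L) v.

(** The width 2 reproduces itself under rescaling, because [(rho + 2) / rho <= 2] for [rho >= 2]. *)
Definition kakeya p K (eta C e : R) : Prop := forall N X T, 1 <= N -> sep X ->
  {in X &, forall x y, bnd N (x - y)} ->
  (forall j t, t \in T j -> angle_le eta t.2 (K j)) ->
  \sum_(x <- X) wprod p (fun j => cntT 2 (T j) x) <=
    C * N `^ e * wprod p (fun j => size (T j)).

Lemma sub_in_count (S : eqType) (a1 a2 : pred S) (s : seq S) :
  {in s, forall x, a1 x -> a2 x} -> (count a1 s <= count a2 s)%N.
Proof.
move=> a12; rewrite -(eq_in_count (a1 := predI (mem s) a1)); last first.
  by move=> x xs /=; rewrite xs.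
rewrite -[leqRHS](eq_in_count (a1 := predI (mem s) a2)); last first.
  by move=> x xs /=; rewrite xs.
by apply: sub_count => x /= /andP[xs /(a12 _ xs)->]; rewrite xs.
Qed.

(* In a ball of radius [rho] the tubes are indistinguishable from translates of
   the [K j], so the parallel inequality applies to them; the tubes meeting the
   ball become, after scaling by [1 / rho], tubes of the original width. *)
Lemma rescale p K b C rho N X T : (forall j, 0 <= p j) -> 2 <= rho ->
  (forall N X A, 1 <= N -> sep X ->
    {in X &, forall x y, nearv fullv 6 (x - y) /\ bnd N (x - y)} ->
    \sum_(x <- X) wprod p (fun j => cnt (K j) 6 (A j) x) <=
    C * N `^ b * wprod p (fun j => size (A j))) ->
  0 <= C -> sep X -> {in X &, forall x y, bnd N (x - y)} ->
  (forall j t, t \in T j -> angle_le rho^-1 t.2 (K j)) ->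
  exists Y T', [/\ sep Y, {in Y &, forall x y, bnd (N / rho) (x - y)},
    (forall j t, t \in T' j -> angle_le rho^-1 t.2 (K j)),
    (forall j, size (T' j) = size (T j)) &
    \sum_(x <- X) wprod p (fun j => cntT 2 (T j) x) <=
    C * (2 * rho) `^ b * \sum_(y <- Y) wprod p (fun j => cntT 2 (T' j) y)].
Proof.
move=> p0 rho2 HC C0 sX dX TK.
have rho0 : 0 < rho by lra.
have rhoU : rho != 0 by rewrite gt_eqF.
have rhoN : `|rho| = rho by rewrite gtr0_norm.
have rhoVN : `|rho^-1| = rho^-1 by rewrite gtr0_norm// invr_gt0.
have [Y [sY YX] XY] := sep_net [seq rho^-1 *: x | x <- X].
pose T' j := [seq (rho^-1 *: t.1, t.2) | t <- T j].
exists Y, T'; split => //.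
- move=> x y /YX/mapP[x' x'X ->] /YX/mapP[y' y'X ->].
  by rewrite -scalerBr mulrC -{1}rhoVN; apply: bndZ; exact: dX.
- by move=> j t /mapP[t' t'T ->]/=; exact: TK t'T.
- by move=> j; rewrite size_map.
pose Xy y := [seq x <- X | `[< bnd 1 (rho^-1 *: x - y) >]].
have XyP y : \sum_(x <- Xy y) wprod p (fun j => cntT 2 (T j) x) <=
    C * (2 * rho) `^ b * wprod p (fun j => cntT 2 (T' j) y).
  have /choice[v vP] : forall t : E * {vspace E}, exists v : E,
      nearv t.2 (rho + 2) (rho *: y - t.1) ->
      v \in t.2 /\ bnd (rho + 2) (rho *: y - t.1 - v).
    move=> t.
    have [[v vt tv]|nt] := pselect (nearv t.2 (rho + 2) (rho *: y - t.1)).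
      by exists v.
    by exists 0 => /nt.
  (* Each tube passing near the ball is represented by a point of its core close to the centre
     [rho *: y]. *)
  pose A j := [seq t.1 + v t | t <- T j
    & `[< nearv t.2 (rho + 2) (rho *: y - t.1) >]].
  have xyb x : x \in Xy y -> bnd rho (x - rho *: y).
    rewrite mem_filter => /andP[/asboolP xy _].
    rewrite (_ : x - _ = rho *: (rho^-1 *: x - y)); last first.
      by rewrite scalerBr scalerA mulfV// scale1r.
    by rewrite -{1}[rho]mulr1 -{1}rhoN; exact: bndZ.
  apply: (@le_trans _ _
    (\sum_(x <- Xy y) wprod p (fun j => cnt (K j) 6 (A j) x))).
    rewrite big_seq [leRHS]big_seq; apply: ler_sum => x /xyb xy.
    apply: wprod_le => // j; rewrite /cnt count_map count_filter /cntT.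
    apply: sub_in_count => t tT /asboolP[w wt xw].
    have yt : nearv t.2 (rho + 2) (rho *: y - t.1).
      exists w => //; rewrite [X in bnd _ X](_ : _ =
        (x - t.1 - w) - (x - rho *: y)); last first.
        by apply/rowP => i; rewrite !mxE; ring.
      by rewrite addrC; exact: bndB.
    have [vt yv] := vP t yt.
    apply/andP; split; apply/asboolP => //=.
    rewrite (_ : x - _ = (w - v t) + (x - t.1 - w)); last first.
      by apply/rowP => i; rewrite !mxE; ring.
    rewrite (_ : 6 = 4 + 2 :> R); last by ring.
    apply: nearvD; last exact: nearv_bnd.
    (* Two core points in this ball differ by at most [2 * rho + 4 <= 4 * rho], so their difference
       is within 4 of [K j]; the tube width adds 2, whence the radius 6. *)
    rewrite (_ : 4 = rho^-1 * (4 * rho)); last by field.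
    apply: TK tT _ _ _ _ _; [lra | by rewrite rpredB|].
    rewrite (_ : w - v t = (x - rho *: y) - (x - t.1 - w) +
      (rho *: y - t.1 - v t)); last first.
      by apply/rowP => i; rewrite !mxE; ring.
    apply: (@bnd_le _ _ (rho + 2 + (rho + 2))); first by lra.
    by apply: bndD => //; exact: bndB.
  apply: le_trans (HC (2 * rho) _ A _ (sep_filter _ sX) _) _.
  - by lra.
  - move=> x x' xX x'X; split.
      by apply: nearv_mem; rewrite ?memvf//; lra.
    rewrite (_ : x - x' = (x - rho *: y) - (x' - rho *: y)); last first.
      by apply/rowP => i; rewrite !mxE; ring.
    by rewrite mulr_natl mulr2n; apply: bndB; exact: xyb.
  - rewrite ler_wpM2l ?mulr_ge0 ?powR_ge0// wprod_le// => j.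
    rewrite /A size_map size_filter /cntT count_map; apply: sub_count => t.
    move=> /asboolP[w wt yw]/=; apply/asboolP; exists (rho^-1 *: w).
      by rewrite memvZ.
    rewrite (_ : y - _ - _ = rho^-1 *: (rho *: y - t.1 - w)); last first.
      by rewrite !scalerBr scalerA mulVf// scale1r.
    apply: (@bnd_le _ _ (`|rho^-1| * (rho + 2))); last exact: bndZ.
    by rewrite rhoVN mulrDr mulVf// mulrC -lerBrDl ler_pdivrMr//; lra.
rewrite mulr_sumr; apply: le_trans (ler_sum _ (fun y _ => XyP y)).
under [leRHS]eq_bigr do rewrite big_filter big_mkcond/=.
rewrite exchange_big/= big_seq [leRHS]big_seq; apply: ler_sum => x xX.
have [y yY xy] := XY _ (map_f _ xX).
rewrite (big_rem y)//= asboolT// lerDl sumr_ge0// => y' _.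
by case: ifP; rewrite ?wprod_ge0.
Qed.

Lemma pow_bracket (rho N : R) : 2 <= rho -> 1 <= N ->
  exists m, N <= rho ^+ m <= rho * N.
Proof.
move=> rho2 N1; have rho0 : 0 < rho by lra.
have ex : exists m, N <= rho ^+ m.
  exists (Num.bound N); rewrite (le_trans (ltW (archi_boundP _)))//; first lra.
  rewrite (@le_trans _ _ (2 ^+ Num.bound N))//.
    by rewrite -natrX ler_nat ltnW// ltn_expl.
  by rewrite lerXn2r// nnegrE; lra.
have [m Nm mmin] := ex_minnP ex; exists m; rewrite Nm/=.
case: m Nm mmin => [|m] Nm mmin.
  by rewrite expr0 (le_trans N1)// ler_peMl//; lra.
rewrite exprS ler_pM2l// leNgt; apply/negP => /ltW/mmin.
by rewrite ltnn.
Qed.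

Theorem kakeya_BL p K b e : (forall j, 0 <= p j) -> 0 <= b -> 0 < e ->
  BL p K fullv b ->
  exists2 eta, 0 < eta & exists2 C, 0 <= C & kakeya p K eta C (b + e).
Proof.
move=> p0 b0 e0 /(_ 6)[//|C C0 HC].
have [D D0 HD] := size_sep (@fullv R 'rV[R]_n) (lexx 0).
(* Chosen so that [rho]^ e[absorbs the loss]C * 2 [^ b] incurred at each scale. *)
pose rho : R := 2 + (C * 2 `^ b) `^ e^-1.
have rho2 : 2 <= rho by rewrite lerDl powR_ge0.
have rho0 : 0 < rho by lra.
have be0 : 0 <= b + e by lra.
have Crho : C * (2 * rho) `^ b <= rho `^ (b + e).
  have -> : rho `^ (b + e) = rho `^ e * rho `^ b.
    by rewrite addrC powRD// lt0r_neq0 ?implybT.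
  have -> : (2 * rho) `^ b = 2 `^ b * rho `^ b by rewrite powRM// ltW.
  rewrite mulrA; apply: ler_wpM2r; first exact: powR_ge0.
  have Cb0 : 0 <= C * 2 `^ b by rewrite mulr_ge0 ?powR_ge0.
  have -> : C * 2 `^ b = ((C * 2 `^ b) `^ e^-1) `^ e.
    by rewrite -powRrM mulVf ?powRr1// lt0r_neq0.
  apply: ge0_ler_powR; first exact: ltW.
  - by rewrite nnegrE powR_ge0.
  - by rewrite nnegrE ltW.
  - by rewrite /rho lerDr.
exists rho^-1; first by rewrite invr_gt0.
(* [D] bounds the number of points at scale at most 1, and the other factor pays for rounding [N] up
   to a power of [rho]. *)
exists (D * rho `^ (b + e)); first by rewrite mulr_ge0 ?powR_ge0.
suff main m : forall N X T, N <= rho ^+ m -> sep X ->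
    {in X &, forall x y, bnd N (x - y)} ->
    (forall j t, t \in T j -> angle_le rho^-1 t.2 (K j)) ->
    \sum_(x <- X) wprod p (fun j => cntT 2 (T j) x) <=
    D * (rho `^ (b + e)) ^+ m * wprod p (fun j => size (T j)).
  move=> N X T N1 sX dX TK; have [m /andP[Nm mN]] := pow_bracket rho2 N1.
  apply: le_trans (main m N X T Nm sX dX TK) _.
  rewrite ler_wpM2r ?wprod_ge0// -[leRHS]mulrA ler_wpM2l//.
  rewrite -powR_mulrn ?powR_ge0// -powRrM mulrC powRrM powR_mulrn ?(ltW rho0)//.
  rewrite -powRM; [|lra..].
  have rN0 : 0 <= rho * N by rewrite mulr_ge0//; lra.
  by apply: ge0_ler_powR => //; rewrite nnegrE// exprn_ge0// ltW.
elim: m => [|m IH] N X T Nm sX dX TK.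
  rewrite expr0 mulr1.
  have dX1 : {in X &, forall x y, nearv fullv 0 (x - y) /\ bnd 1 (x - y)}.
    move=> x y xX yX; split; first by apply: nearv_mem; rewrite ?memvf.
    by apply: bnd_le Nm _; exact: dX.
  have := HD _ _ (lexx _) sX dX1; rewrite powR1 mulr1 => XD.
  rewrite (le_trans _ (ler_wpM2r (wprod_ge0 _ _) XD))// -sumr_const_seq.
  apply: ler_sum => x _; apply: wprod_le => // j; exact: count_size.
have [Y [T' [sY dY T'K sT' XY]]] := rescale p0 rho2 HC C0 sX dX TK.
apply: le_trans XY _.
have Nm' : N / rho <= rho ^+ m by rewrite ler_pdivrMr// mulrC -exprS.
have := IH _ _ _ Nm' sY dY T'K.
have -> : wprod p (fun j => size (T' j)) = wprod p (fun j => size (T j)).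
  by apply: eq_bigr => j _; rewrite sT'.
move=> YD; rewrite exprS mulrCA -[leRHS]mulrA.
apply: ler_pM => //; first by rewrite mulr_ge0 ?powR_ge0.
by apply: sumr_ge0 => y _; exact: wprod_ge0.
Qed.

End multiscale.

(** * Compactness and perturbation of the directions *)

Section box.
Import numFieldNormedType.Exports.
Context {R : realType} {I : finType}.
Local Notation box := (prod_topology (fun _ : I => R : topologicalType)).

Lemma near_box (x : box) (e : R) : 0 < e ->
  \forall y \near x, forall i, `|y i - x i| < e.
Proof.
move=> e0; apply: (@filter_forall box I
  (fun i => [set y : box | `|y i - x i| < e]) (nbhs x)) => i.
have pc : (fun y : box => y i : R) @ x --> (x i : R).
  exact: (@proj_continuous I (fun _ : I => R : topologicalType) i x).
have /(_ (nbhs_filter x)) := @cvgr_dist_lt R R box (nbhs x) _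
  (fun y : box => y i) (x i) pc e e0.
by apply: (@filterS box (nbhs x) (nbhs_filter x)) => y /=; rewrite distrC.
Qed.

(** The cube is compact by Tychonoff's theorem, and monotonicity in [k] turns a finite cover into
    one common [k]. *)
Lemma box_unif (B : R) (Q : nat -> box -> Prop) :
  (forall k l x, (k <= l)%N -> Q k x -> Q l x) ->
  (forall x : box, (forall i, `|x i| <= B) ->
    exists k, \forall y \near x, Q k y) ->
  exists k, forall x : box, (forall i, `|x i| <= B) -> Q k x.
Proof.
move=> Qmono Qloc.
have : compact [set x : box | forall i, `[- B, B]%classic (x i)].
  apply: (@tychonoff I (fun=> R : topologicalType)
    (fun=> `[- B, B]%classic)) => i.
  exact: segment_compact.
move=> /compact_near_coveringP/(_ nat \oo Q _)[|k _ kQ].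
  move=> x xB; have [|k xk] := Qloc x.
    by move=> i; have := xB i; rewrite /= in_itv/= -ler_norml.
  exists ([set y | Q k y], [set l | (k <= l)%N]) => /=.
    by split=> //; exists k.
  by move=> [y l] /= [yk kl]; exact: Qmono yk.
exists k => x xB; apply: (kQ k) => //= i.
by rewrite in_itv/= -ler_norml.
Qed.

End box.

(** * Subspaces encoded by their projection matrices *)

Section projection_matrix.
Context {R : realType} {n : nat}.
Local Notation E := 'rV[R]_n.
Implicit Types (V W : {vspace E}) (M P : 'M[R]_n).

Definition pmx V : 'M[R]_n := lin1_mx (orthproj V).

(** Recovers a subspace from its projection matrix but makes sense for every matrix, so that the
    parameters can range over a full cube. *)
Definition fixv M : {vspace E} := lker (linfun (mulmxr (1%:M - M)) : 'End(E)).

Lemma fixvP M x : reflect (x *m M = x) (x \in fixv M).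
Proof.
rewrite memv_ker lfunE/= mulmxBr mulmx1 subr_eq0 eq_sym; exact: eqP.
Qed.

Lemma mul_pmx V x : x *m pmx V = orthproj V x.
Proof. exact: mul_rV_lin1. Qed.

Lemma orthproj_id V x : x \in V -> orthproj V x = x.
Proof. by apply: daddv_pi_id; rewrite capv_perp. Qed.

Lemma fixv_pmx V : fixv (pmx V) = V.
Proof.
apply/vspaceP => x; apply/idP/idP => [/fixvP <-|xV].
  by rewrite mul_pmx; have [] := orthprojP V x.
by apply/fixvP; rewrite mul_pmx orthproj_id.
Qed.

Lemma pmx_idem V : pmx V *m pmx V = pmx V.
Proof.
apply/row_matrixP => i; rewrite row_mul !rowE mul_pmx.
by rewrite mul_pmx orthproj_id//; have [] := orthprojP V (delta_mx 0 i).
Qed.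

Lemma pmx_sub V W : (V <= W)%VS -> pmx V *m pmx W = pmx V.
Proof.
move=> /subvP VW; apply/row_matrixP => i; rewrite row_mul !rowE !mul_pmx.
by rewrite orthproj_id//; apply: VW; have [] := orthprojP V (delta_mx 0 i).
Qed.

(** An idempotent factors as [C *m B] with [B *m C] the identity, and the trace is cyclic. Thus
    fixing a dimension becomes a polynomial equation. *)
Lemma dim_fixv P : P *m P = P -> (\dim (fixv P))%:R = \tr P :> R.
Proof.
move=> PP; set U := fixv P; pose b := vbasis U.
pose B := \matrix_(i < \dim U) b`_i.
pose C := \matrix_(a < n, k < \dim U) coord b k (row a P).
have rPU a : row a P \in U by apply/fixvP; rewrite -row_mul PP.
have bU (i : 'I_(\dim U)) : b`_i \in U.
  by apply: vbasis_mem; rewrite mem_nth// size_tuple.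
have PE : P = C *m B.
  apply/row_matrixP => a; rewrite row_mul mulmx_sum_row.
  rewrite [LHS](coord_vbasis (rPU a)); apply: eq_bigr => k _.
  by rewrite !mxE rowK.
have BC : B *m C = 1%:M.
  apply/matrixP => i k; rewrite !mxE.
  transitivity (coord b k (b`_i *m P)).
    rewrite mulmx_sum_row linear_sum; apply: eq_bigr => a _.
    by rewrite linearZ/= !mxE.
  rewrite (fixvP _ _ (bU i)) coord_free ?(basis_free (vbasisP _))//.
by rewrite PE mxtrace_mulC BC mxtrace1.
Qed.

Lemma dotv_coord_le (x : E) i : x 0 i ^+ 2 <= dotv x x.
Proof.
rewrite dotvE (bigD1 i)//= -expr2 lerDl sumr_ge0// => j _.
by rewrite -expr2 sqr_ge0.
Qed.

Lemma coord_enorm (x : E) i : `|x 0 i| <= enorm x.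
Proof. by rewrite -sqrtr_sqr ler_wsqrtr// dotv_coord_le. Qed.

Lemma dotv_delta (i : 'I_n) : dotv (delta_mx 0 i) (delta_mx 0 i : E) = 1.
Proof.
rewrite dotvE (bigD1 i)//= big1 ?addr0; first by rewrite !mxE !eqxx mul1r.
by move=> j ji; rewrite !mxE (negPf ji) andbF mul0r.
Qed.

(** By Pythagoras, the projection of a unit vector has norm at most 1. *)
Lemma pmx_le1 V i j : `|pmx V i j| <= 1.
Proof.
pose e : E := delta_mx 0 i; pose v := orthproj V e.
have -> : pmx V i j = v 0 j.
  by rewrite /v -mul_pmx /e -rowE [RHS]mxE.
have [vV /mem_orthovP/(_ _ vV) ev] := orthprojP V e.
rewrite -(@ler_pXn2r _ 2)// ?nnegrE// expr1n.
rewrite -normrX ger0_norm ?sqr_ge0// (le_trans (dotv_coord_le _ _))//.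
have ee : e = (e - v) + v by rewrite subrK.
rewrite -(dotv_delta i) -/e [in leRHS]ee.
have e0 : 0 <= dotv (e - v) (e - v).
  by rewrite dotvE sumr_ge0// => k _; rewrite -expr2 sqr_ge0.
have ve : dotv (e - v) v = 0 := ev.
have {}ev : dotv v (e - v) = 0.
  rewrite -ve !dotvE; apply: eq_bigr => k _; exact: mulrC.
suff -> : dotv ((e - v) + v) ((e - v) + v) = dotv (e - v) (e - v) + dotv v v.
  by rewrite lerDr.
transitivity (dotv (e - v) (e - v) + dotv v v +
  (dotv v (e - v) + dotv (e - v) v)).
  by rewrite !dotvE -!big_split/=; apply: eq_bigr => k _; rewrite !mxE; ring.
by rewrite ev ve !addr0.
Qed.

Lemma pmx_gdist V W i j : `|pmx V i j - pmx W i j| <= gdist V W.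
Proof.
pose f := (orthproj V - orthproj W)%R; pose e : E := delta_mx 0 i.
have -> : pmx V i j - pmx W i j = f e 0 j.
  rewrite /f add_lfunE opp_lfunE -!mul_pmx -!rowE !mxE; by [].
apply: le_trans (coord_enorm _ _) _; rewrite /gdist /opnorm.
apply: sup_upper_bound; first exact: opnorm_has_sup.
by exists e => //=; rewrite /enorm dotv_delta sqrtr1.
Qed.

Lemma mul_close M M' (e L : R) (v : E) : (forall i j, `|M i j - M' i j| <= e) ->
  bnd L v -> bnd (n%:R * (L * e)) (v *m (M - M')).
Proof.
move=> MM' Lv j; rewrite mxE (le_trans (ler_norm_sum _ _ _))//.
apply: (@le_trans _ _ (\sum_(i < n) L * e)); last first.
  by rewrite sumr_const card_ord mulr_natl.
by apply: ler_sum => i _; rewrite normrM !mxE ler_pM.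
Qed.

End projection_matrix.

(** * Continuity of matrix expressions *)

Section continuity.
Import numFieldNormedType.Exports.
Context {R : realType} {T : topologicalType}.

Lemma cvg_sumr (I : Type) (r : seq I) (F : I -> T -> R) (l : I -> R) (x : T) :
  (forall i, (F i : T -> R) @ x --> (l i : R)) ->
  (fun y => \sum_(i <- r) F i y : R) @ x --> (\sum_(i <- r) l i : R).
Proof.
move=> Fl; elim: r => [|i r IH].
  rewrite big_nil (_ : (fun y => _) = (fun=> 0)); first exact: cvg_cst.
  by apply/funext => y; rewrite big_nil.
rewrite big_cons (_ : (fun y => _) = (fun y => F i y + \sum_(j <- r) F j y)).
  by apply: cvgD.
by apply/funext => y; rewrite big_cons.
Qed.

Definition mxcont (m n : nat) (F : T -> 'M[R]_(m, n)) : Prop :=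
  forall i j (x : T), (fun y => F y i j : R) @ x --> (F x i j : R).

Lemma mxcont_mul m n l (F : T -> 'M[R]_(m, n)) (G : T -> 'M[R]_(n, l)) :
  mxcont F -> mxcont G -> mxcont (fun x => F x *m G x).
Proof.
move=> cF cG i j x.
have -> : (fun y => (F y *m G y) i j) = (fun y => \sum_k F y i k * G y k j).
  by apply/funext => y; rewrite mxE.
rewrite mxE; apply: cvg_sumr => k.
by apply: cvgM; [exact: cF | exact: cG].
Qed.

Lemma mxcont_neq m n (F G : T -> 'M[R]_(m, n)) (x : T) : mxcont F -> mxcont G ->
  F x <> G x -> \forall y \near x, F y <> G y.
Proof.
move=> cF cG neq.
have [i [j ij]] : exists i j, F x i j - G x i j != 0.
  apply: contrapT => h; apply: neq; apply/matrixP => i j; apply/eqP.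
  rewrite -subr_eq0; apply/negPn/negP => ij; apply: h; by exists i, j.
have c : (fun y => F y i j - G y i j : R) @ x --> (F x i j - G x i j : R).
  by apply: cvgB; [exact: cF | exact: cG].
have := @cvgr_neq0 R R T (nbhs x) (nbhs_filter x) _ _ c ij.
apply: (@filterS T (nbhs x) (nbhs_filter x)) => y /= h FG.
by move: h; rewrite FG subrr eqxx.
Qed.

Lemma mxtrace_near n (F : T -> 'M[R]_n) (x : T) (c : R) : mxcont F ->
  \tr (F x) <> c -> \forall y \near x, \tr (F y) <> c.
Proof.
move=> cF neq.
have ct : (fun y => \tr (F y) - c : R) @ x --> (\tr (F x) - c : R).
  apply: cvgB; last exact: cvg_cst.
  by apply: cvg_sumr => i; exact: cF.
have neq0 : \tr (F x) - c != 0 by rewrite subr_eq0; exact/eqP.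
have := @cvgr_neq0 R R T (nbhs x) (nbhs_filter x) _ _ ct neq0.
apply: (@filterS T (nbhs x) (nbhs_filter x)) => y /= h FG.
by move: h; rewrite FG subrr eqxx.
Qed.

End continuity.

(** * Upper semicontinuity of intersection dimensions *)

Section semicontinuity.
Import numFieldNormedType.Exports.
Context {R : realType} {n J : nat}.
Local Notation E := 'rV[R]_n.
Implicit Types (V W : {vspace E}).

Let I := (option ('I_J + 'I_J) * 'I_n * 'I_n)%type.
Local Notation box := (prod_topology (fun _ : I => R : topologicalType)).

(* A point of the box lists the entries of a matrix [P] (index [None]), of
   matrices [Q_j] (index [inl j]) and of matrices [M_j] (index [inr j]). The
   polynomial system [eqs] says that [P] projects onto a [V] of dimension [s.1]
   and [Q_j] onto a subspace of [V :&: fixv M_j] of dimension [s.2 j]. *)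
Let mx (x : box) (o : option ('I_J + 'I_J)) : 'M[R]_n :=
  \matrix_(a, c) x (o, a, c).

Let mx_cont o : mxcont (fun x => mx x o).
Proof.
move=> i j x; have -> : (fun y => mx y o i j) = (fun y : box => y (o, i, j)).
  by apply/funext => y; rewrite mxE.
rewrite mxE.
exact: (@proj_continuous I (fun _ : I => R : topologicalType) (o, i, j) x).
Qed.

Let absorb_near o o' (x : box) : mx x o *m mx x o' <> mx x o ->
  \forall y \near x, mx y o *m mx y o' <> mx y o.
Proof.
move=> neq; apply: (@mxcont_neq _ _ _ _ (fun y => mx y o *m mx y o')
  (fun y => mx y o)) => //.
by apply: mxcont_mul; exact: mx_cont.
Qed.

Let eqsj (x : box) (j : 'I_J) (m : nat) : Prop :=
  let Q := mx x (Some (inl j)) in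
  [/\ Q *m Q = Q, \tr Q = m%:R, Q *m mx x None = Q &
      Q *m mx x (Some (inr j)) = Q].

Let eqs (s : nat * {ffun 'I_J -> nat}) (x : box) : Prop :=
  [/\ mx x None *m mx x None = mx x None, \tr (mx x None) = s.1%:R &
      forall j, eqsj x j (s.2 j)].

Let eqsj_near x j m : ~ eqsj x j m -> \forall y \near x, ~ eqsj y j m.
Proof.
have fS := @filterS box (nbhs x) (nbhs_filter x).
rewrite /eqsj; set q := Some (inl j) => /= nj.
have [f1|H] := pselect (mx x q *m mx x q = mx x q); last first.
  by apply: fS (absorb_near H) => y h [].
have [f2|H] := pselect (\tr (mx x q) = m%:R); last first.
  by apply: fS (mxtrace_near (@mx_cont _) H) => y h [].
have [f3|H] := pselect (mx x q *m mx x None = mx x q); last first.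
  by apply: fS (absorb_near H) => y h [].
have [f4|H] := pselect (mx x q *m mx x (Some (inr j)) = mx x q); last first.
  by apply: fS (absorb_near H) => y h [].
by case: nj.
Qed.

Let eqs_near s x : ~ eqs s x -> \forall y \near x, ~ eqs s y.
Proof.
move=> ns; have fS := @filterS box (nbhs x) (nbhs_filter x).
have [e1|H] := pselect (mx x None *m mx x None = mx x None); last first.
  by apply: fS (absorb_near H) => y h [].
have [e2|H] := pselect (\tr (mx x None) = s.1%:R); last first.
  by apply: fS (mxtrace_near (@mx_cont _) H) => y h [].
have /existsNP[j nj] : ~ forall j, eqsj x j (s.2 j).
  by move=> h; apply: ns; split.
by apply: fS (eqsj_near nj) => y h [_ _ /(_ j)].
Qed.

Let invS_small (e : R) : 0 < e -> exists k, k.+1%:R^-1 < e.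
Proof.
move=> e0; have ei : 0 <= e^-1 by rewrite invr_ge0 ltW.
exists (Num.bound e^-1); rewrite invf_plt ?posrE//.
by rewrite (lt_trans (archi_boundP ei))// ltr_nat.
Qed.

Let far (x y z k : R) : k < `|x - z| / 2 -> `|y - x| < `|x - z| / 2 ->
  `|y - z| <= k -> False.
Proof.
have : `|x - z| <= `|x - y| + `|y - z|.
  by rewrite (le_trans _ (ler_normD _ _))// addrA subrK.
by rewrite (distrC x y); lra.
Qed.

(** If a tuple of dimensions is not attained at [V0], the system [eqs] has no solution over [V0],
    hence by compactness none over a neighbourhood of [V0]. There are finitely many tuples. *)
Lemma semicontinuity (V0 : 'I_J -> {vspace E}) : exists2 nu : R, 0 < nu &
  forall M : 'I_J -> 'M[R]_n,
  (forall j a c, `|M j a c - pmx (V0 j) a c| <= nu) ->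
  forall V, exists2 V' : {vspace E}, \dim V' = \dim V &
    forall j, (\dim (V :&: fixv (M j)) <= \dim (V' :&: V0 j))%N.
Proof.
pose real (s : nat * {ffun 'I_J -> nat}) :=
  exists2 V' : {vspace E}, \dim V' = s.1 &
    forall j, (s.2 j <= \dim (V' :&: V0 j))%N.
pose Q s k (x : box) :=
  (forall j a c, `|x (Some (inr j), a, c) - pmx (V0 j) a c| <= k.+1%:R^-1) ->
  ~ eqs s x.
have Qbox s : exists k,
    real s \/ forall x : box, (forall i, `|x i| <= 2) -> Q s k x.
  have [rs|nrs] := pselect (real s); first by exists 0%N; left.
  suff [k kQ] : exists k, forall x : box, (forall i, `|x i| <= 2) -> Q s k x.
    by exists k; right.
  apply: box_unif => [k l x kl Qk xl|x _].
    apply: Qk => j a c; rewrite (le_trans (xl j a c))//.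
    by rewrite lef_pV2 ?posrE// ler_nat.
  have [xM|] :=
    pselect (forall j, mx x (Some (inr j)) = pmx (V0 j)); last first.
    (* Off [V0], the closeness hypothesis of [Q] fails near [x] once [k] is large. *)
    move=> /existsNP[j neq].
    have [a [c]] : exists a c, mx x (Some (inr j)) a c - pmx (V0 j) a c != 0.
      apply: contrapT => h; apply: neq; apply/matrixP => a c; apply/eqP.
      rewrite -subr_eq0; apply/negPn/negP => ij; apply: h; by exists a, c.
    rewrite mxE -normr_gt0; set e := `| _ | => e0.
    have e20 : 0 < e / 2 by rewrite divr_gt0.
    have [k ke] := invS_small e20.
    exists k; apply: (@filterS box (nbhs x) (nbhs_filter x)) (near_box x e20).
    move=> y xy /(_ j a c) yk _.
    exact: (far ke (xy (Some (inr j), a, c)) yk).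
  (* Over [V0], a solution would attain the tuple of dimensions, and unsolvability is an open
     condition. *)
  exists 0%N; apply: (@filterS box (nbhs x) (nbhs_filter x))
    (_ : \forall y \near x, ~ eqs s y).
    by move=> y + _.
  apply: eqs_near => -[PP trP H]; apply: nrs.
  exists (fixv (mx x None)).
    by apply/eqP; rewrite -(eqr_nat R) dim_fixv// trP.
  move=> j; have [QQ trQ QP QM] := H j.
  have <- : \dim (fixv (mx x (Some (inl j)))) = s.2 j.
    by apply/eqP; rewrite -(eqr_nat R) dim_fixv// trQ.
  apply: dimvS; apply/subvP => v /fixvP vQ; rewrite memv_cap; apply/andP; split.
    by apply/fixvP; rewrite -vQ -mulmxA QP.
  rewrite -[V0 j]fixv_pmx; apply/fixvP; rewrite -vQ -mulmxA -xM QM.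
  by [].
have /choice[l lP] := Qbox.
pose s0 (s : 'I_n.+1 * {ffun 'I_J -> 'I_n.+1}) : nat * {ffun 'I_J -> nat} :=
  (s.1 : nat, [ffun j => s.2 j : nat]).
pose L := \max_s l (s0 s).
exists L.+1%:R^-1; first by rewrite invr_gt0.
move=> M MP V.
pose s : 'I_n.+1 * {ffun 'I_J -> 'I_n.+1} :=
  (inord (\dim V), [ffun j => inord (\dim (V :&: fixv (M j)))]).
have s01 : (s0 s).1 = \dim V by rewrite /= inordK ?dimv_ltS.
have s02 j : (s0 s).2 j = \dim (V :&: fixv (M j)).
  by rewrite /= !ffunE inordK ?dimv_ltS.
have [[V' dV' capV']|HQ] := lP (s0 s).
  by exists V'; [rewrite dV' s01|move=> j; rewrite -s02].
pose PQM (o : option ('I_J + 'I_J)) : 'M[R]_n := match o with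
  | None => pmx V
  | Some (inl j) => pmx (V :&: fixv (M j))
  | Some (inr j) => M j end.
pose y : box := fun oac => PQM oac.1.1 oac.1.2 oac.2.
have mxy o : mx y o = PQM o.
  by apply/matrixP => a c; rewrite mxE.
have L1 : L.+1%:R^-1 <= 1 :> R by rewrite invf_le1// ler1n.
have ybox i : `|y i| <= 2.
  case: i => [[[[j|j]|] a] c]; rewrite /y/=.
  - by rewrite (le_trans (pmx_le1 _ _ _))// ler1n.
  - rewrite -[M j a c](subrK (pmx (V0 j) a c)) (le_trans (ler_normD _ _))//.
    by rewrite -[2]/(1 + 1) lerD ?pmx_le1// (le_trans (MP j a c)).
  - by rewrite (le_trans (pmx_le1 _ _ _))// ler1n.
exfalso; apply: (HQ y ybox).
  move=> j a c; rewrite /y/= (le_trans (MP j a c))// lef_pV2 ?posrE//.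
  by rewrite ler_nat ltnS /L (leq_bigmax s).
split; rewrite ?mxy ?pmx_idem//.
  by rewrite -(dim_fixv (pmx_idem V)) fixv_pmx s01.
move=> j; rewrite /eqsj !mxy; split.
- exact: pmx_idem.
- by rewrite -(dim_fixv (pmx_idem _)) fixv_pmx s02.
- by apply: pmx_sub; exact: capvSl.
- apply/row_matrixP => i; rewrite row_mul; apply/fixvP.
  rewrite rowE mul_pmx.
  have [+ _] := orthprojP (V :&: fixv (M j)) (delta_mx 0 i).
  by rewrite memv_cap => /andP[].
Qed.

End semicontinuity.

(** * Estimates uniform in the directions *)

Section uniform.
Import numFieldNormedType.Exports.
Context {R : realType} {n J : nat}.
Local Notation E := 'rV[R]_n.
Local Notation tubes := (seq (E * {vspace E})).
Implicit Types (V W : {vspace E}) (p : 'I_J -> R) (M : 'I_J -> 'M[R]_n).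

(** A vector [v] of [V] is fixed by [pmx V], so [v - v *m M] is small and [nearv_ker] applies. *)
Lemma fixv_close (M : 'M[R]_n) (eta : R) : 0 < eta -> exists2 d, 0 < d &
  forall V, (forall a c, `|pmx V a c - M a c| <= d) -> angle_le eta V (fixv M).
Proof.
move=> eta0.
have [D D0 HD] := nearv_ker (linfun (mulmxr (1%:M - M)) : 'End(E)).
have Dn : 0 < D * n%:R + 1 by rewrite ltr_wpDl// mulr_ge0.
exists (eta / (D * n%:R + 1)); first by rewrite divr_gt0.
move=> V VM L v L0 vV Lv.
have := @mul_close _ _ (pmx V) M _ L v VM Lv.
have -> : v *m (pmx V - M) = linfun (mulmxr (1%:M - M)) v :> E.
  by rewrite lfunE/= !mulmxBr mulmx1 mul_pmx orthproj_id.
move=> /HD; apply: nearv_le; rewrite !mulrA ler_pdivrMr//.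
have : 0 <= eta * L by rewrite mulr_ge0// ltW.
have -> : D * n%:R * L * eta = D * n%:R * (eta * L) by ring.
have -> : eta * L * (D * n%:R + 1) = D * n%:R * (eta * L) + eta * L by ring.
by lra.
Qed.

(* One integer [k] bounds both the constant and the inverse of the aperture, so
   that compactness of the set of directions yields a common [k]. *)
Definition ukakeya p M (k : nat) (e : R) : Prop :=
  forall N (X : seq E) (T : 'I_J -> tubes),
  1 <= N -> sep X -> {in X &, forall x y, bnd N (x - y)} ->
  (forall j t, t \in T j ->
    forall a c, `|pmx t.2 a c - M j a c| <= k.+1%:R^-1) ->
  \sum_(x <- X) wprod p (fun j => cntT 2 (T j) x) <=
    k%:R * N `^ e * wprod p (fun j => size (T j)).

Lemma ukakeya_le p M k l e : (k <= l)%N -> ukakeya p M k e -> ukakeya p M l e.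
Proof.
move=> kl H N X T N1 sX dX TM.
apply: le_trans (H N X T N1 sX dX _) _.
  move=> j t tT a c; apply: le_trans (TM j t tT a c) _.
  by rewrite lef_pV2 ?posrE// ler_nat.
by rewrite ler_wpM2r ?wprod_ge0// ler_wpM2r ?powR_ge0// ler_nat.
Qed.

(** Half of the aperture allowed around [M] is left for the tubes, the other half for moving [M]. *)
Lemma ukakeya_local p M b e : (forall j, 0 <= p j <= 1) -> 0 <= b -> 0 < e ->
  (forall V, exc p (fun j => fixv (M j)) V <= b) ->
  exists k, exists2 d, 0 < d &
    forall M', (forall j a c, `|M' j a c - M j a c| < d) ->
    ukakeya p M' k (b + e).
Proof.
move=> p01 b0 e0 pb.
have p0 j : 0 <= p j by have /andP[] := p01 j.
have [|eta eta0 [C C0 HC]] :=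
  @kakeya_BL R n J p (fun j => fixv (M j)) b e p0 b0 e0.
  by apply: BL_exc => // V _; exact: pb.
have /choice[d dP] : forall j, exists d, 0 < d /\
    forall V, (forall a c, `|pmx V a c - M j a c| <= d) ->
      angle_le eta V (fixv (M j)).
  by move=> j; have [d d0 dP] := fixv_close (M j) eta0; exists d.
have [D D0 DP] : exists2 D, 0 < D & forall j, D <= d j.
  have S0 (P : pred 'I_J) : 0 <= \sum_(j | P j) (d j)^-1.
    by apply: sumr_ge0 => j _; rewrite invr_ge0 ltW//; have [] := dP j.
  have S1 : 0 < 1 + \sum_j (d j)^-1 by rewrite ltr_pwDl.
  exists (1 + \sum_j (d j)^-1)^-1; first by rewrite invr_gt0.
  move=> j; have [dj _] := dP j.
  by rewrite invf_ple ?posrE// (bigD1 j)//= addrCA lerDl addr_ge0.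
exists (Num.bound (C + (D / 2)^-1)), (D / 2); first by rewrite divr_gt0.
move=> M' M'M N X T N1 sX dX TM.
set k := Num.bound _ in TM *.
have D2 : 0 < (D / 2)^-1 by rewrite invr_gt0 divr_gt0.
have kb : C + (D / 2)^-1 < k%:R by apply: archi_boundP; rewrite addr_ge0// ltW.
apply: le_trans (HC N X T N1 sX dX _) _; last first.
  rewrite ler_wpM2r ?wprod_ge0// ler_wpM2r ?powR_ge0//.
  by apply: ltW; apply: le_lt_trans kb; rewrite lerDl ltW.
move=> j t tT; have [_ H] := dP j; apply: H => a c.
apply: le_trans (DP j).
have kD : k.+1%:R^-1 <= D / 2.
  rewrite invf_ple ?posrE ?divr_gt0// ltW// (lt_le_trans (y := k%:R))//.
    by apply: le_lt_trans kb; rewrite lerDr.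
  by rewrite ler_nat.
have : `|pmx t.2 a c - M j a c| <=
    `|pmx t.2 a c - M' j a c| + `|M' j a c - M j a c|.
  by rewrite (le_trans _ (ler_normD _ _))// addrA subrK.
move=> /le_trans; apply; apply: (@le_trans _ _ (D / 2 + D / 2)); last first.
  by rewrite -splitr.
by apply: lerD; [exact: le_trans (TM j t tT a c) kD | exact: ltW].
Qed.

Let I := ('I_J * 'I_n * 'I_n)%type.
Local Notation box := (prod_topology (fun _ : I => R : topologicalType)).

Lemma ukakeya_unif p (V0 : 'I_J -> {vspace E}) b : (forall j, 0 <= p j <= 1) ->
  0 <= b -> (forall V, exc p V0 V <= b) ->
  exists2 nu, 0 < nu & forall e, 0 < e -> exists k, forall M,
    (forall j a c, `|M j a c - pmx (V0 j) a c| <= nu) -> ukakeya p M k (b + e).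
Proof.
move=> p01 b0 pb; have [nu nu0 HV] := semicontinuity V0.
have p0 j : 0 <= p j by have /andP[] := p01 j.
have nu2 : 0 < nu / 2 by rewrite divr_gt0.
(* The half gives a margin where the semicontinuity radius is left; the bound 1 keeps the entries of
   [M] in the cube of size 2. *)
exists (Num.min (nu / 2) 1); first by rewrite lt_min nu2 ltr01.
move=> e e0.
pose mx (x : box) j : 'M[R]_n := \matrix_(a, c) x (j, a, c).
pose Q k (x : box) :=
  (forall j a c, `|x (j, a, c) - pmx (V0 j) a c| <= nu / 2) ->
  ukakeya p (mx x) k (b + e).
have [|x _|k kP] := @box_unif R I 2 Q.
- by move=> k l x kl Qk xl; apply: ukakeya_le kl _; exact: Qk.
- have fS := @filterS box (nbhs x) (nbhs_filter x).
  have [xV|] :=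
    pselect (forall j a c, `|mx x j a c - pmx (V0 j) a c| <= nu); last first.
    move=> /existsNP[j /existsNP[a /existsNP[c]]]; rewrite mxE => /negP far.
    exists 0%N; apply: fS (near_box x nu2) => y xy yV; exfalso.
    move: far; apply/negP/negPn.
    apply: le_trans (_ : `|x (j, a, c) - y (j, a, c)| +
      `|y (j, a, c) - pmx (V0 j) a c| <= _).
      by rewrite (le_trans _ (ler_normD _ _))// addrA subrK.
    by rewrite [leRHS](splitr nu) lerD// distrC ltW.
  have [|k [d d0 kd]] := @ukakeya_local p (mx x) b e p01 b0 e0.
    (* Equal dimensions and larger intersections mean smaller ranks, so [exc] at [V] is at most
       [exc p V0 V']. *)
    move=> V; have [V' dV' capV'] := HV _ xV V; apply: le_trans (pb V').
    rewrite /exc dV' lerD2l lerN2 ler_sum// => j _; rewrite ler_wpM2l// !rkE.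
    by rewrite dV' lerD2l lerN2 ler_nat.
  exists k; apply: fS (near_box x d0) => y xy _.
  by apply: kd => j a c; rewrite !mxE.
exists k => M MV.
have := kP (fun jac => M jac.1.1 jac.1.2 jac.2); rewrite /Q.
rewrite (_ : mx _ = M); last first.
  by apply/funext => j; apply/matrixP => a c; rewrite mxE.
apply.
  move=> [[j a] c] /=; rewrite -[M j a c](subrK (pmx (V0 j) a c)).
  rewrite (le_trans (ler_normD _ _))// -[2]/(1 + 1) lerD ?pmx_le1//.
  by rewrite (le_trans (MV j a c))// ge_min lexx orbT.
by move=> j a c /=; rewrite (le_trans (MV j a c))// ge_min lexx.
Qed.

End uniform.

(** * Finite partition of the directions *)

Section discrete.
Context {R : realType} {n J : nat}.
Local Notation E := 'rV[R]_n.
Local Notation tubes := (seq (E * {vspace E})).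
Implicit Types (V W : {vspace E}) (p : 'I_J -> R) (M : 'I_J -> 'M[R]_n).

Lemma count_classes (T : Type) (S : finType) (g : T -> S) (a : pred T)
  (s : seq T) :
  count a s = (\sum_c count a [seq t <- s | g t == c])%N.
Proof.
elim: s => [|t s IH] /=; first by rewrite big1.
rewrite IH (bigD1 (g t))//= [RHS](bigD1 (g t))//= eqxx/= addnA; congr (_ + _)%N.
by apply: eq_bigr => c; rewrite eq_sym => /negPf ->.
Qed.

(** The sum is at most [#|S|] times its largest term, and the power [q <= 1] of [#|S|] is at most
    [#|S|]. *)
Lemma powR_sum_le (S : finType) (c : S -> nat) (q : R) :
  0 <= q <= 1 -> (0 < #|S|)%N ->
  (\sum_s c s)%N%:R `^ q <= #|S|%:R * \sum_s (c s)%:R `^ q.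
Proof.
move=> /andP[q0 q1] S0; have /card_gt0P[s1 _] := S0.
case: (@arg_maxnP S s1 xpredT c isT) => s0 _ smax.
apply: (@le_trans _ _ ((#|S| * c s0)%N%:R `^ q)).
  apply: ge0_ler_powR; rewrite ?nnegrE// ler_nat.
  rewrite -sum_nat_const; apply: leq_sum => s _; exact: smax.
rewrite natrM powRM// (bigD1 s0)//=; apply: ler_pM; rewrite ?powR_ge0//.
  by rewrite -[leRHS]powRr1//; apply: ler_powR => //; rewrite ler1n.
by rewrite lerDl sumr_ge0// => s _; exact: powR_ge0.
Qed.

(** The aperture from [ukakeya_unif] depends on [e] while [nu] must not. The directions are
    therefore cut into classes of that size, and the estimate is summed over choices of one class
    per [j]. *)
Theorem discrete_kakeya p (V0 : 'I_J -> {vspace E}) b :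
  (forall j, 0 <= p j <= 1) -> 0 <= b -> (forall V, exc p V0 V <= b) ->
  exists2 nu, 0 < nu & forall e, 0 < e -> exists2 C, 0 < C &
    forall N (X : seq E) (T : 'I_J -> tubes), 1 <= N -> sep X ->
    {in X &, forall x y, bnd N (x - y)} ->
    (forall j t, t \in T j ->
      forall a c, `|pmx t.2 a c - pmx (V0 j) a c| <= nu) ->
    \sum_(x <- X) wprod p (fun j => cntT 2 (T j) x) <=
      C * N `^ (b + e) * wprod p (fun j => size (T j)).
Proof.
move=> p01 b0 pb; have [nu nu0 H] := ukakeya_unif p01 b0 pb.
have p0 j : 0 <= p j by have /andP[] := p01 j.
exists nu => // e e0; have [k kP] := H e e0.
pose K := Num.truncn (2 * k.+1%:R : R).
pose S : finType := {ffun 'I_n * 'I_n -> 'I_K.+1}.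
(* Tubes in the same class have directions within [k.+1%:R^-1]. *)
pose cls (t : E * {vspace E}) : S :=
  [ffun ac => inord (Num.truncn ((pmx t.2 ac.1 ac.2 + 1) * k.+1%:R))].
have cls_close t t' : cls t = cls t' ->
    forall a c, `|pmx t.2 a c - pmx t'.2 a c| <= k.+1%:R^-1.
  move=> tt' a c; have /ffunP/(_ (a, c)) := tt'; rewrite !ffunE/=.
  have range (V : {vspace E}) : 0 <= (pmx V a c + 1) * k.+1%:R <= 2 * k.+1%:R.
    have := pmx_le1 V a c; rewrite ler_norml => /andP[l u].
    apply/andP; split; first by rewrite mulr_ge0//; lra.
    by rewrite ler_wpM2r//; lra.
  move=> /(inord_truncn_eq (range _) (range _)).
  rewrite -mulrBl opprD addrACA subrr addr0 normrM [X in _ * X]ger0_norm//.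
  by move=> /ltW; rewrite -ler_pdivlMr// mul1r.
have S0 : (0 < #|S|)%N by rewrite card_ffun card_ord expn_gt0.
pose C : R := #|S|%:R ^+ J * (#|{ffun 'I_J -> S}|%:R * k%:R).
exists (C + 1).
  by rewrite ltr_wpDl// !mulr_ge0// exprn_ge0.
move=> N X T N1 sX dX TV.
pose Tc j c := [seq t <- T j | cls t == c].
have pt x : wprod p (fun j => cntT 2 (T j) x) <=
    #|S|%:R ^+ J * \sum_(f : {ffun 'I_J -> S})
      wprod p (fun j => cntT 2 (Tc j (f j)) x).
  rewrite [X in _ <= _ * X](_ : _ = \prod_j \sum_(c : S)
    (cntT 2 (Tc j c) x)%:R `^ p j); last by rewrite bigA_distr_bigA.
  rewrite -[X in _ ^+ X]card_ord -prodr_const -big_split/=.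
  apply: ler_prod => j _; rewrite powR_ge0/=.
  by rewrite {1}/cntT (count_classes cls) powR_sum_le.
apply: le_trans (ler_sum _ (fun x _ => pt x)) _.
rewrite -mulr_sumr exchange_big/=.
have clsbound (f : {ffun 'I_J -> S}) :
    \sum_(x <- X) wprod p (fun j => cntT 2 (Tc j (f j)) x) <=
    k%:R * N `^ (b + e) * wprod p (fun j => size (T j)).
  (* An empty class is represented by [V0 j], which keeps the centre within [nu]. *)
  pose rep j := head (0, V0 j) (Tc j (f j)).
  have repP j : rep j = (0, V0 j) \/ rep j \in Tc j (f j).
    rewrite /rep; case: (Tc j (f j)) => [|t s]; first by left.
    by right; rewrite mem_head.
  apply: le_trans (kP (fun j => pmx (rep j).2) _ N X _ N1 sX dX _) _.
  - move=> j a c; have [->|] := repP j; first by rewrite subrr normr0 ltW.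
    by rewrite mem_filter => /andP[_ /TV]; exact.
  - move=> j t tT; apply: cls_close.
    have : rep j \in Tc j (f j).
      move: tT; rewrite /rep; case: (Tc j (f j)) => // t' s _.
      by rewrite mem_head.
    by move: tT; rewrite !mem_filter => /andP[/eqP-> _] /andP[/eqP-> _].
  - rewrite ler_wpM2l ?mulr_ge0 ?powR_ge0// wprod_le// => j.
    by rewrite size_filter count_size.
apply: le_trans (_ : #|S|%:R ^+ J * (#|{ffun 'I_J -> S}|%:R *
   (k%:R * N `^ (b + e) * wprod p (fun j => size (T j)))) <= _).
  rewrite ler_wpM2l ?exprn_ge0//.
  apply: le_trans (ler_sum _ (fun f _ => clsbound f)) _.
  by rewrite sumr_const -[leLHS]mulr_natl.
set w := wprod p _; set Ne := N `^ _.
have -> : #|S|%:R ^+ J * (#|{ffun 'I_J -> S}|%:R * (k%:R * Ne * w)) =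
    C * Ne * w.
  by rewrite /C !mulrA.
by rewrite ler_wpM2r ?wprod_ge0// ler_wpM2r ?powR_ge0// lerDl.
Qed.

End discrete.

(** * Passage to the integral *)

(* Unlike [ge0_le_integral], no measurability is required. *)
Lemma le_integral_ge0 d (T : measurableType d) (R : realType)
  (mu : {measure set T -> \bar R}) (D : set T) (f g : T -> \bar R) :
  (forall x, D x -> (0 <= f x)%E) -> (forall x, D x -> (f x <= g x)%E) ->
  (\int[mu]_(x in D) f x <= \int[mu]_(x in D) g x)%E.
Proof.
move=> f0 fg; rewrite !ge0_integralE//; last first.
  by move=> x Dx; rewrite (le_trans (f0 _ Dx))// fg.
apply: le_ereal_sup => _ [h hf <-]; exists h => // x.
by rewrite (le_trans (hf x))// lee_restrict.
Qed.

(** * Comparison of the integral with a sum over cells *)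

Section cells.
Context {R : realType} {n : nat}.
Local Notation RM := (measurableTypeR R).
Local Notation mu := (@lebesgue_tuple R n).
Context (lo w : R) (M : nat) (w_gt0 : 0 < w).

(** The closed cells overlap on their faces, which is harmless for an upper bound. *)
Definition side (k : nat) : set RM :=
  `[lo + k%:R * w, lo + k%:R * w + w]%classic.

Definition cell (c : {ffun 'I_n -> 'I_M}) : set (n.-tuple RM) :=
  [set t | forall i, side (c i) (tnth t i)].

Lemma measurable_box (A : 'I_n -> set RM) : (forall i, measurable (A i)) ->
  measurable [set t : n.-tuple RM | forall i, A i (tnth t i)].
Proof.
move=> mA.
rewrite (_ : [set t | _] =
  \bigcap_(i in [set: 'I_n]) ((@tnth n RM)^~ i @^-1` A i)).
  apply: fin_bigcap_measurable => // i _; rewrite -[X in measurable X]setTI.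
  exact: measurable_tnth.
by apply/seteqP; split=> t /= tA i; [move=> _; exact: tA|exact: tA].
Qed.

Lemma measurable_cell c : measurable (cell c).
Proof.
apply: (measurable_box (A := fun i => side (c i))) => i.
exact: measurable_itv.
Qed.

Lemma cell_measure c : mu (cell c) = (w ^+ n)%:E.
Proof.
rewrite /cell (@lebesgue_tuple_box _ _ (fun i => side (c i))).
  rewrite (eq_bigr (fun=> w%:E)) => [|i _].
    by rewrite -(big_morph EFin (@EFinM R) erefl) prodr_const card_ord.
  rewrite /side lebesgue_measure_itv/= lte_fin ltrDl w_gt0 -EFinD.
  by rewrite addrAC subrr add0r.
by move=> i; exact: measurable_itv.
Qed.

Lemma integral_cells (D : set (n.-tuple RM)) (f : n.-tuple RM -> R)
    (v : {ffun 'I_n -> 'I_M} -> R) :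
  measurable D -> (forall t, D t -> 0 <= f t) -> (forall c, 0 <= v c) ->
  (forall t, D t -> exists c, cell c t) ->
  (forall t c, D t -> cell c t -> f t <= v c) ->
  (\int[mu]_(t in D) (f t)%:E <= ((\sum_c v c) * w ^+ n)%:E)%E.
Proof.
move=> mD f0 v0 Dcell fv.
apply: (@le_trans _ _
  (\int[mu]_(t in D) \sum_c (v c)%:E * (\1_(cell c) t)%:E)%E).
  apply: le_integral_ge0 => t Dt; first by rewrite lee_fin f0.
  have [c tc] := Dcell _ Dt.
  rewrite (bigD1 c)//= indicE mem_set// mule1.
  rewrite (le_trans (_ : (f t)%:E <= (v c)%:E)%E)//.
    by rewrite lee_fin fv.
  by rewrite leeDl// sume_ge0// => c' _; rewrite mule_ge0// lee_fin.
rewrite ge0_integral_sum//; last 2 first.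
- move=> c; apply/measurable_EFinP/measurable_funM => //.
  by apply: measurable_indic; exact: measurable_cell.
- by move=> c t _; rewrite mule_ge0// lee_fin.
rewrite mulr_suml -sumEFin; apply: lee_sum => c _.
rewrite ge0_integralZl_EFin//; last first.
  by apply/measurable_EFinP; apply: measurable_indic; exact: measurable_cell.
rewrite integral_indic//; last exact: measurable_cell.
rewrite EFinM lee_wpmul2l ?lee_fin// -(cell_measure c).
apply: le_measure; rewrite ?inE; [|exact: measurable_cell|exact: subIsetl].
by apply: measurableI => //; exact: measurable_cell.
Qed.

End cells.

(** * From the exponent and tubes of the statement to the discrete ones *)

Section final.
Context {R : realType} {n J : nat}.
Local Notation E := 'rV[R]_n.
Implicit Types (U V W : {vspace E}) (K : 'I_J -> {vspace E}) (p : 'I_J -> R).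

Lemma exc_max p K : exists V0, forall V, exc p K V <= exc p K V0.
Proof.
have [S [V_ [_ HV]]] := exc_finite K fullv.
have [s0 _] := HV _ (subvf 0).
case: (@arg_maxP _ _ _ s0 xpredT (fun s => exc p K (V_ s)) isT) => s _ smax.
by exists (V_ s) => V; have [s' ->] := HV _ (subvf V); exact: smax.
Qed.

Lemma perp_perp W : perp (perp W) = W.
Proof.
have WW : (W <= perp (perp W))%VS.
  apply/subvP => x xW; apply/mem_orthovP => v /mem_orthovP/(_ _ xW) vx.
  have {}vx : dotv v x = 0 := vx.
  suff : dotv x v = 0 by [].
  by rewrite -vx !dotvE; apply: eq_bigr => i _; rewrite mulrC.
apply/eqP; rewrite eqEsubv WW andbT; apply/subvP => x xWW.
have [aW xa] := orthprojP W x.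
have : x - orthproj W x \in (perp W :&: perp (perp W))%VS.
  by rewrite memv_cap xa rpredB//; exact: (subvP WW).
by rewrite capv_perp memv0 subr_eq0 => /eqP ->.
Qed.

Lemma lker_orthproj W : lker (orthproj W) = perp W.
Proof.
apply/vspaceP => x; rewrite memv_ker; have [px xp] := orthprojP W x.
apply/eqP/idP => [p0|xW]; first by move: xp; rewrite p0 subr0.
have : orthproj W x \in (W :&: perp W)%VS.
  by rewrite memv_cap px/= -[orthproj W x](subKr x) rpredB.
by rewrite capv_perp memv0 => /eqP.
Qed.

(** The projection onto the complement of [K j] has kernel [K j]; rank-nullity on [V] concludes. *)
Lemma rk_orthproj K j V : rk K j V = (\dim (orthproj (perp (K j)) @: V)%VS)%:R.
Proof.
rewrite rkE -{1}(limg_ker_dim (orthproj (perp (K j))) V) lker_orthproj.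
by rewrite perp_perp natrD addrAC subrr add0r.
Qed.

Lemma nbhd_affine_nearv (d : R) (a x : E) V : 0 <= d ->
  nbhd d (affine a V) x -> nearv V d (x - a).
Proof.
move=> d0 [_ [v vV <-] xav]; exists v => // i.
by rewrite -addrA -opprD (le_trans (coord_enorm _ _))// ltW.
Qed.

Lemma nearvZ (c d : R) V x : nearv V d x -> nearv V (`|c| * d) (c *: x).
Proof.
move=> [v vV dv]; exists (c *: v); first exact: memvZ.
by rewrite -scalerBr; exact: bndZ.
Qed.

Lemma sum_indic_count (S : seq (set E)) (x : E) :
  \sum_(T <- S) \1_T x = (count (fun T => `[< T x >]) S)%:R :> R.
Proof.
elim: S => [|T S IH]; first by rewrite big_nil.
by rewrite big_cons IH/= natrD indicE; congr (_ + _).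
Qed.

End final.

Lemma natr_inj_lt1 (R : realType) (k l : nat) : `|k%:R - l%:R : R| < 1 -> k = l.
Proof.
rewrite ltr_norml => /andP[? ?]; apply/eqP; rewrite eqn_leq.
have le (a c : nat) : a%:R < c%:R + 1 :> R -> (a <= c)%N.
  by rewrite natr1 ltr_nat ltnS.
by rewrite !le//; lra.
Qed.

Theorem theorem2 (R : realType) (n J : nat) (n_gt0 : (0 < n)%N)
  (J_gt0 : (0 < J)%N) (p : 'I_J -> R) (p01 : forall j, 0 <= p j <= 1)
  (n' : 'I_J -> nat) (V0 : 'I_J -> {vspace 'rV[R]_n})
  (dimV0 : forall j, \dim (V0 j) = n' j) :
  exists2 nu : R, 0 < nu &
  forall eps : R, 0 < eps ->
  exists2 C : R, 0 < C &
  forall delta : R, 0 < delta <= 1 ->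
  forall TT : 'I_J -> {fset (set 'rV[R]_n)},
  (forall j T, T \in TT j -> tube (n' j) delta nu (V0 j) T) ->
  (\int[lebesgue_tuple n]_(t in
       [set t | forall i, (-1 <= tnth t i <= 1)%R])
     (\prod_(j < J) (\sum_(T <- TT j) \1_T (\row_i tnth t i)) `^ p j)%R%:E
   <= (C * delta `^ (- eps + n%:R))%R%:E
      * ereal_sup (range (fun V : {vspace 'rV[R]_n} =>
          (delta `^ (- (\dim V)%:R
             + \sum_(j < J)
                 p j * (\dim (orthproj (perp (V0 j)) @: V)%VS)%:R))%R%:E))
      * (\prod_(j < J) (#|` TT j|%:R `^ p j))%R%:E)%E.
Proof.
have p0 j : 0 <= p j by have /andP[] := p01 j.
have [Vm Vmax] := exc_max p V0; set b := exc p V0 Vm in Vmax.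
have b0 : 0 <= b by rewrite -(exc0 p V0).
have [nu nu0 H] := discrete_kakeya p01 b0 Vmax.
exists nu => // eps eps0; have [C C0 HC] := H eps eps0.
(* The factor comes from taking [N] to be [3 / delta], above the diameter [2 / delta] of the
   rescaled cube. *)
exists (C * 3 `^ (b + eps)); first by rewrite mulr_gt0// powR_gt0.
move=> delta /andP[d0 d1] TT TTtube.
have dV0 : 0 < delta^-1 by rewrite invr_gt0.
have dV1 : 1 <= delta^-1 by rewrite invf_ge1.
have dU : delta != 0 by rewrite gt_eqF.
(* Cells of side [delta] starting at -1 cover the cube, the last ones possibly sticking out; [pt c]
   is the lower corner of a cell divided by [delta]. *)
pose M := (Num.truncn (2 * delta^-1)).+1.
pose pt (c : {ffun 'I_n -> 'I_M}) : 'rV[R]_n := \row_i ((c i)%:R - delta^-1).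
pose X := [seq pt c | c : {ffun 'I_n -> 'I_M}].
(* A tube is given only as a set, so a base point and a direction are fixed for each. *)
have /choice[tb tbP] : forall jT : 'I_J * set 'rV[R]_n,
    exists t : 'rV[R]_n * {vspace 'rV[R]_n}, jT.2 \in TT jT.1 ->
    jT.2 = nbhd delta (affine t.1 t.2) /\ gdist t.2 (V0 jT.1) <= nu.
  move=> [j T] /=; have [TTj|_] := boolP (T \in TT j); last by exists (0, 0%VS).
  by have [a [V [_ VV0 TE]]] := TTtube j T TTj; exists (a, V).
pose TJ j := [seq (delta^-1 *: (tb (j, T)).1, (tb (j, T)).2) | T <- TT j].
pose v c := wprod p (fun j => cntT 2 (TJ j) (pt c)).
have sumv : \sum_c v c <=
    C * (3 * delta^-1) `^ (b + eps) * wprod p (fun j => #|` TT j|).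
  have -> : \sum_c v c = \sum_(x <- X) wprod p (fun j => cntT 2 (TJ j) x).
    by rewrite big_image.
  have -> : wprod p (fun j => #|` TT j|) = wprod p (fun j => size (TJ j)).
    by apply: eq_bigr => j _; rewrite size_map.
  have pt_inj (c c' : {ffun 'I_n -> 'I_M}) :
      (forall i, `|(pt c - pt c') 0 i| < 1) -> c = c'.
    move=> cc'; apply/ffunP => i; apply/val_inj/(@natr_inj_lt1 R).
    have := cc' i; rewrite !mxE.
    by rewrite (_ : _ - _ = (c i)%:R - (c' i)%:R)//; ring.
  apply: HC.
  - by lra.
  - split.
      rewrite map_inj_uniq ?enum_uniq// => c c' e; apply: pt_inj => i.
      by rewrite e subrr mxE normr0.
    by move=> _ _ /mapP[c _ ->] /mapP[c' _ ->] /pt_inj ->.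
  - move=> _ _ /mapP[c _ ->] /mapP[c' _ ->] i; rewrite !mxE.
    have cM (k : 'I_M) : 0 <= (k%:R : R) <= 2 * delta^-1.
      rewrite ler0n/= -truncn_ge_nat ?mulr_ge0 ?(ltW dV0)//.
      by rewrite -ltnS.
    have := cM (c i); have := cM (c' i) => /andP[? ?] /andP[? ?].
    by rewrite ler_norml; apply/andP; split; lra.
  - move=> j t /mapP[T TTj ->] a c /=; apply: le_trans (pmx_gdist _ _ _ _) _.
    by have [] := tbP (j, T) TTj.
have integ := @integral_cells R n (-1) delta M d0
  [set t | forall i, (-1 <= tnth t i <= 1)%R]
  (fun t => \prod_(j < J) (\sum_(T <- TT j) \1_T (\row_i tnth t i)) `^ p j) v.
have dK (x : R) : x * delta^-1 * delta = x by rewrite mulfVK.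
apply: le_trans (integ _ _ _ _ _) _.
- rewrite (_ : [set t | _] = [set t | forall i, `[-1, 1]%classic (tnth t i)]).
    apply: (measurable_box (A := fun=> `[-1, 1]%classic)) => i.
    exact: measurable_itv.
  by apply/seteqP; split=> t tD i; have := tD i; rewrite /= in_itv.
- by move=> t _; apply: prodr_ge0 => j _; exact: powR_ge0.
- by move=> c; exact: wprod_ge0.
- move=> t tD.
  exists [ffun i => inord (Num.truncn ((tnth t i + 1) * delta^-1))].
  move=> i; have /andP[tl tu] := tD i.
  rewrite ffunE /side /= in_itv/= inordK; last first.
    rewrite ltnS; apply/le_truncn/ler_wpM2r; first exact: ltW.
    by lra.
  set u := (tnth t i + 1) * delta^-1.
  have u0 : 0 <= u by rewrite mulr_ge0 ?(ltW dV0)//; lra.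
  have ut : u * delta = tnth t i + 1 by rewrite /u dK.
  have /andP[] := truncn_itv u0.
  rewrite -natr1 -(ler_pM2r d0) -(ltr_pM2r d0) ut.
  by rewrite mulrDl mul1r => ? ?; apply/andP; split; lra.
- move=> t c tD tc.
  rewrite (_ : \prod_(j < J) _ = wprod p (fun j =>
      count (fun T => `[< T (\row_i tnth t i) >]) (TT j))); last first.
    by apply: eq_bigr => j _; rewrite sum_indic_count.
  apply: wprod_le => // j; rewrite /cntT count_map.
  apply: sub_in_count => T TTj.
  move=> /asboolP Tx /=; apply/asboolP.
  have [/= TE _] := tbP (j, T) TTj; rewrite TE in Tx.
  have := nearvZ delta^-1 (nbhd_affine_nearv (ltW d0) Tx).
  rewrite ger0_norm ?(ltW dV0)// mulVf// => near1.
  rewrite (_ : pt c - _ = delta^-1 *: ((\row_i tnth t i) - (tb (j, T)).1) +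
      (pt c - delta^-1 *: \row_i tnth t i)); last first.
    by rewrite scalerBr; apply/rowP => i; rewrite !mxE; ring.
  (* The rescaled tube has width 1, and the corner is within 1 of every point of its rescaled
     cell. *)
  rewrite -[2]/(1 + 1); apply: nearvD => //; apply: nearv_bnd => i.
  have := tc i; rewrite /side /= in_itv/= => /andP[l u].
  rewrite !mxE (_ : _ - _ =
    (-1 + (c i)%:R * delta - tnth t i) * delta^-1); last first.
    by field.
  rewrite normrM [X in _ * X]ger0_norm ?(ltW dV0)// ler_pdivrMr// mul1r.
  by rewrite ler_norml; apply/andP; split; lra.
(* The supremum is bounded below by its value at the maximiser [Vm] of [exc]. *)
have supV : ((delta `^ (- b))%:E <=
    ereal_sup (range (fun V : {vspace 'rV[R]_n} =>
      (delta `^ (- (\dim V)%:R + \sum_(j < J)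
         p j * (\dim (orthproj (perp (V0 j)) @: V)%VS)%:R))%R%:E)))%E.
  apply: ereal_sup_ubound; exists Vm => //; congr (_ `^ _)%:E.
  rewrite /b /exc opprB addrC; congr (_ + _); apply: eq_bigr => j _.
  by rewrite rk_orthproj.
set S := ereal_sup _ in supV *.
set P := \prod_(j < J) _.
have P0 : 0 <= P by apply: prodr_ge0 => j _; exact: powR_ge0.
apply: (@le_trans _ _ ((C * 3 `^ (b + eps) * delta `^ (- eps + n%:R))%:E *
    (delta `^ (- b))%:E * P%:E)%E); last first.
  apply: lee_wpmul2r; first by rewrite lee_fin.
  by apply: lee_wpmul2l => //; rewrite lee_fin !mulr_ge0 ?powR_ge0// ltW.
rewrite -!EFinM lee_fin.
apply: le_trans (ler_wpM2r (exprn_ge0 _ (ltW d0)) sumv) _.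
rewrite -[wprod _ _]/P le_eqVlt; apply/orP; left; apply/eqP.
have -> : (3 * delta^-1) `^ (b + eps) = 3 `^ (b + eps) * delta `^ (- (b + eps)).
  rewrite powRM ?(ltW dV0)//; congr (_ * _).
  by rewrite -powR_inv1 ?(ltW d0)// -powRrM mulN1r.
have dn : delta `^ (- (b + eps)) * delta ^+ n =
    delta `^ (- eps + n%:R) * delta `^ (- b).
  rewrite -powR_mulrn ?(ltW d0)// -!powRD ?dU ?implybT//; congr (_ `^ _); ring.
transitivity (C * 3 `^ (b + eps) * P * (delta `^ (- (b + eps)) * delta ^+ n)).
  by ring.
by rewrite dn; ring.
Qed.
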